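(* There exist a finitely generated free group $\Gamma$ and a properly discontinuous action of $\Gamma$ on $\mathrm{AdS}^3$ by isometries such that there is no fundamental domain for this action in $\mathrm{AdS}^3$ bounded by pairwise disjoint $\mathrm{AdS}$ crooked planes.
   Context: Let $\mathbb{H}^2$ be the hyperbolic plane and $\overline{\mathbb{H}^2}=\mathbb{H}^2\cup\partial_\infty\mathbb{H}^2$. Let $G=\mathrm{PGL}_2(\mathbb{R})=\mathrm{Isom}(\mathbb{H}^2)$ and $G_0=\mathrm{PSL}_2(\mathbb{R})$. Anti-de Sitter $3$-space $\mathrm{AdS}^3$ is $G_0$ with the bi-invariant Lorentzian metric induced by half the Killing form. The group $(G\times G)_+=\{(g_1,g_2)\in G\times G: g_1g_2\in G_0\}$ of orientation-preserving isometries acts by $(g_1,g_2)\cdot g=g_2gg_1^{-1}$. For a geodesic line $\ell$ of $\mathbb{H}^2$ with closure $\overline\ell\subset\overline{\mathbb{H}^2}$, let $\mathsf{C}(\ell)\subset G_0$ be the set of $h\in G_0$ having a nonrepelling fixed point in $\overline{\ell}$ (the identity fixes every point; an elliptic element has its fixed point in $\mathbb{H}^2$; a parabolic element its fixed point at infinity; for a hyperbolic element only its attracting fixed point counts as nonrepelling). A left $\mathrm{AdS}$ crooked plane is a set $g_2\mathsf{C}(\ell)g_1^{-1}$ with $g_1,g_2\in G_0$; a right $\mathrm{AdS}$ crooked plane is the image of a left one under $g\mapsto g^{-1}$. An $\mathrm{AdS}$ crooked plane is a left or right one; each separates $\mathrm{AdS}^3$ into two components. A fundamental domain bounded by pairwise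 disjoint crooked planes means a closed region $\mathsf{R}\subset\mathrm{AdS}^3$ whose boundary is the union of finitely many pairwise disjoint $\mathrm{AdS}$ crooked planes, whose translates under the group cover $\mathrm{AdS}^3$ and have pairwise disjoint interiors. *)

(* Defs.v *)
From Stdlib Require Import Reals List.
Open Scope R_scope.

Record M2 := mkM2 { m11 : R; m12 : R; m21 : R; m22 : R }.

Definition mdet (A : M2) : R := m11 A * m22 A - m12 A * m21 A.

Definition mmul (A B : M2) : M2 :=
  mkM2 (m11 A * m11 B + m12 A * m21 B) (m11 A * m12 B + m12 A * m22 B)
       (m21 A * m11 B + m22 A * m21 B) (m21 A * m12 B + m22 A * m22 B).

Definition mopp (A : M2) : M2 := mkM2 (- m11 A) (- m12 A) (- m21 A) (- m22 A).

Definition minv (A : M2) : M2 :=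
  let d := mdet A in
  mkM2 (m22 A / d) (- m12 A / d) (- m21 A / d) (m11 A / d).

(** * AdS^3 = PSL_2(R): points are represented by matrices of determinant 1,
    a point of PSL_2(R) being the pair {A, -A}.  A subset of AdS^3 is
    represented by a predicate on matrices which is invariant under A |-> -A
    on SL_2(R) (values off SL_2(R) are irrelevant). *)
Definition ads_pt (A : M2) : Prop := mdet A = 1.

Definition aset (S : M2 -> Prop) : Prop :=
  forall A, ads_pt A -> (S A <-> S (mopp A)).

Definition mdist (A B : M2) : R :=
  Rabs (m11 A - m11 B) + Rabs (m12 A - m12 B)
  + Rabs (m21 A - m21 B) + Rabs (m22 A - m22 B).

Definition mnorm (A : M2) : R :=
  Rabs (m11 A) + Rabs (m12 A) + Rabs (m21 A) + Rabs (m22 A).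

(** the classes of A and B in PSL_2(R) are at distance < e *)
Definition near (e : R) (A B : M2) : Prop :=
  mdist A B < e \/ mdist A (mopp B) < e.

Definition interior (S : M2 -> Prop) (A : M2) : Prop :=
  ads_pt A /\ exists e, 0 < e /\ forall B, ads_pt B -> near e A B -> S B.

Definition closure (S : M2 -> Prop) (A : M2) : Prop :=
  ads_pt A /\ forall e, 0 < e -> exists B, ads_pt B /\ S B /\ near e A B.

Definition closed (S : M2 -> Prop) : Prop :=
  forall A, closure S A -> S A.

Definition boundary (S : M2 -> Prop) (A : M2) : Prop :=
  closure S A /\ ~ interior S A.

(** compact subsets of PSL_2(R): closed and bounded (the projection
    SL_2(R) -> PSL_2(R) is proper and SL_2(R) is closed in R^4) *)
Definition compact (K : M2 -> Prop) : Prop :=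
  aset K /\ closed K /\
  exists M, forall A, ads_pt A -> K A -> mnorm A <= M.

(** * The closed hyperbolic plane (upper half-plane model) *)
Inductive Hbar : Type :=
| HP (x y : R)   (* the point x + i y of H^2, with y > 0 *)
| BP (x : R)     (* the boundary point x of R ∪ {∞} *)
| Inf.

Definition in_Hbar (p : Hbar) : Prop :=
  match p with HP _ y => 0 < y | _ => True end.

Definition mob (h : M2) (p : Hbar) : Hbar :=
  let a := m11 h in let b := m12 h in let c := m21 h in let d := m22 h in
  match p with
  | HP x y =>
      let D := (c * x + d) ^ 2 + (c * y) ^ 2 in
      HP (((a * x + b) * (c * x + d) + a * c * y ^ 2) / D) (mdet h * y / D)
  | BP x => if Req_EM_T (c * x + d) 0 then Inf else BP ((a * x + b) / (c * x + d))
  | Inf => if Req_EM_T c 0 then Inf else BP (a / c)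
  end.

(** Geodesic lines of H^2: vertical lines Re z = a, and half-circles of
    center c (on the real axis) and radius r > 0. *)
Inductive geod : Type :=
| Vert (a : R)
| Semi (c r : R).

Definition geod_valid (l : geod) : Prop :=
  match l with Vert _ => True | Semi _ r => 0 < r end.

Definition in_geod_closure (l : geod) (p : Hbar) : Prop :=
  match l with
  | Vert a =>
      match p with
      | HP x y => x = a /\ 0 < y
      | BP x => x = a
      | Inf => True
      end
  | Semi c r =>
      match p with
      | HP x y => 0 < y /\ (x - c) ^ 2 + y ^ 2 = r ^ 2
      | BP x => x = c - r \/ x = c + r
      | Inf => False
      end
  end.

(** p is a nonrepelling fixed point of h (det h = 1).  A fixed point in H^2 is
    always nonrepelling (elliptic or identity).  A boundary fixed point is the
    projective class of an eigenvector of h, of eigenvalue lambda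
    (lambda = c x + d for the eigenvector (x,1), lambda = a for (1,0)); it is
    repelling iff |lambda| < 1 (the repelling fixed point of a hyperbolic
    element); parabolic elements and the identity have |lambda| = 1, the
    attracting fixed point of a hyperbolic element has |lambda| > 1. *)
Definition nonrepelling_fixed (h : M2) (p : Hbar) : Prop :=
  mob h p = p /\
  match p with
  | HP _ _ => True
  | BP x => 1 <= Rabs (m21 h * x + m22 h)
  | Inf => 1 <= Rabs (m11 h)
  end.

Definition Cset (l : geod) (h : M2) : Prop :=
  ads_pt h /\ exists p, in_Hbar p /\ in_geod_closure l p /\ nonrepelling_fixed h p.

(** left AdS crooked plane g2 C(l) g1^{-1}, g1, g2 in G_0 :
    B ∈ g2 C(l) g1^{-1}  iff  g2^{-1} B g1 ∈ C(l) *)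
Definition left_crooked_plane (S : M2 -> Prop) : Prop :=
  exists (l : geod) (g1 g2 : M2),
    geod_valid l /\ ads_pt g1 /\ ads_pt g2 /\
    forall B, ads_pt B -> (S B <-> Cset l (mmul (mmul (minv g2) B) g1)).

Definition right_crooked_plane (S : M2 -> Prop) : Prop :=
  exists T, left_crooked_plane T /\
    forall B, ads_pt B -> (S B <-> T (minv B)).

Definition crooked_plane (S : M2 -> Prop) : Prop :=
  left_crooked_plane S \/ right_crooked_plane S.

(** * Elements of (G x G)_+ : pairs (g1, g2) of elements of PGL_2(R),
    represented by matrices of determinant ±1, with g1 g2 ∈ PSL_2(R). *)
Definition isom_plus (g : M2 * M2) : Prop :=
  (mdet (fst g) = 1 \/ mdet (fst g) = -1) /\ mdet (snd g) = mdet (fst g).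

Definition act_pair (g : M2 * M2) (A : M2) : M2 :=
  mmul (mmul (snd g) A) (minv (fst g)).

Definition act_pair_inv (g : M2 * M2) (A : M2) : M2 :=
  mmul (mmul (minv (snd g)) A) (fst g).

(** * The free group F_n on generators 0..n-1: reduced words.
    A letter (i, false) is the generator i, (i, true) its inverse. *)
Definition letter := (nat * bool)%type.

Fixpoint no_cancel (w : list letter) : Prop :=
  match w with
  | l1 :: ((l2 :: _) as t) =>
      ~ (fst l1 = fst l2 /\ snd l1 <> snd l2) /\ no_cancel t
  | _ => True
  end.

Definition reduced (n : nat) (w : list letter) : Prop :=
  Forall (fun l => (fst l < n)%nat) w /\ no_cancel w.

Definition act_letter (gen : nat -> M2 * M2) (l : letter) (A : M2) : M2 :=
  if snd l then act_pair_inv (gen (fst l)) A else act_pair (gen (fst l)) A.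

Definition act_word (gen : nat -> M2 * M2) (w : list letter) (A : M2) : M2 :=
  fold_right (act_letter gen) A w.

Definition properly_discontinuous (n : nat) (gen : nat -> M2 * M2) : Prop :=
  forall K, compact K ->
    exists L : list (list letter),
      forall w, reduced n w ->
        (exists A, ads_pt A /\ K A /\ K (act_word gen w A)) -> In w L.

Definition translate (gen : nat -> M2 * M2) (w : list letter) (S : M2 -> Prop)
  (B : M2) : Prop :=
  exists A, ads_pt A /\ S A /\ (B = act_word gen w A \/ B = mopp (act_word gen w A)).

Definition crooked_fundamental_domain (n : nat) (gen : nat -> M2 * M2)
  (Rg : M2 -> Prop) : Prop :=
  aset Rg /\ closed Rg /\
  (exists P : list (M2 -> Prop),
     (forall S, In S P -> crooked_plane S) /\
     (forall i j, (i < length P)%nat -> (j < length P)%nat -> i <> j ->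
        forall A, ads_pt A ->
          ~ (nth i P (fun _ => False) A /\ nth j P (fun _ => False) A)) /\
     (forall A, ads_pt A -> (boundary Rg A <-> exists S, In S P /\ S A))) /\
  (forall A, ads_pt A -> exists w, reduced n w /\ translate gen w Rg A) /\
  (forall w w', reduced n w -> reduced n w' -> w <> w' ->
     forall A, ~ (interior (translate gen w Rg) A /\ interior (translate gen w' Rg) A)).

(* Main.v *)
(** Let Gamma(2) = <a, b> act on PSL_2(R) by left multiplication.

    A left crooked plane is the zero set of a continuous function: after
    translation on both sides it is {sep = 0}, where [sep h] has the sign of the
    side of the geodesic on which the nonrepelling fixed point of h lies.  Right
    crooked planes are the images of these under inversion.  A one-parameter
    group of boosts crosses {sep = 0} monotonically, and {sep = 0} is connected,
    so a region bounded by disjoint crooked planes lies locally on one and the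
    same side of a boundary plane S all along S.  It therefore suffices to find,
    for every crooked plane S, some g <> 1 in Gamma(2) and a point h of S with
    g^-1 h in S, such that arbitrarily close to h there are points x with x and
    g^-1 x on any prescribed common side of S: then the interiors of the region
    and of its translate by g overlap.

    Such points exist on the wings of S (where h fixes an endpoint of the
    geodesic) as soon as the matrix of g in a basis adapted to the two endpoints is
    triangular, or has a diagonal entry in absolute value in (0, 1) and another
    one above 1.  For a parabolic g = 1 + N in Gamma(2) the diagonal entries are
    1 + z and 1 - z with z = 2 Q(p, q), where Q is an indefinite binary
    quadratic form of discriminant 1 determined by the geodesic and (p, q) any primitive
    integer vector.  As such a form has a nontrivial integer value below 1/2 in
    absolute value, every crooked plane is excluded. *)

From Stdlib Require Import Reals List Lra Lia Psatz ZArith Classical ClassicalEpsilon.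
Require Import Defs.
Import ListNotations.
Open Scope R_scope.

(** Where the formula for [sep] comes from: for a matrix with rows (a, b), (c, d), trace t and sigma
    = [sigma t], the eigenvalue of larger modulus is (t + sigma)/2, and both (a - d + sigma, 2 c)
    and (2 b, d - a + sigma) are eigenvectors for it when nonzero. Hence c (a - d + sigma) and b (d
    - a + sigma) both have the sign of the attracting fixed point; [sep] is their sum, which
    survives when one of the two vectors degenerates. For elliptic elements sigma = 0 and b c < 0,
    so that what remains, (c - b)(a - d), has the sign of the real part (a - d)/(2 c).

    Nothing in the notion of a fundamental domain tells on which side of a boundary plane the region
    lies, or that it lies on one side only. So the argument extracts just one sign [eta] for which
    the region contains the side locally, and the overlapping pairs have to be produced for both
    signs. *)

(** * Matrix algebra *)

Definition mI : M2 := mkM2 1 0 0 1.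
Definition adj (A : M2) : M2 := mkM2 (m22 A) (- m12 A) (- m21 A) (m11 A).

Lemma M2_eq (A B : M2) :
  m11 A = m11 B -> m12 A = m12 B -> m21 A = m21 B -> m22 A = m22 B -> A = B.
Proof. destruct A, B; cbn; intros; subst; reflexivity. Qed.

Lemma mmul_assoc (A B C : M2) : mmul A (mmul B C) = mmul (mmul A B) C.
Proof. apply M2_eq; cbn; ring. Qed.

Lemma mmul_1_l (A : M2) : mmul mI A = A.
Proof. apply M2_eq; cbn; ring. Qed.

Lemma mmul_1_r (A : M2) : mmul A mI = A.
Proof. apply M2_eq; cbn; ring. Qed.

Lemma mdet_mmul (A B : M2) : mdet (mmul A B) = mdet A * mdet B.
Proof. unfold mdet; cbn; ring. Qed.

Lemma mdet_adj (A : M2) : mdet (adj A) = mdet A.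
Proof. unfold mdet; cbn; ring. Qed.

Lemma mdet_mopp (A : M2) : mdet (mopp A) = mdet A.
Proof. unfold mdet; cbn; ring. Qed.

Lemma adj_adj (A : M2) : adj (adj A) = A.
Proof. apply M2_eq; cbn; ring. Qed.

Lemma adj_mmul (A B : M2) : adj (mmul A B) = mmul (adj B) (adj A).
Proof. apply M2_eq; cbn; ring. Qed.

Lemma mmul_adj_r (A : M2) : mdet A = 1 -> mmul A (adj A) = mI.
Proof. unfold mdet; intro H; apply M2_eq; cbn; try ring; rewrite <- H; ring. Qed.

Lemma mmul_adj_l (A : M2) : mdet A = 1 -> mmul (adj A) A = mI.
Proof. unfold mdet; intro H; apply M2_eq; cbn; try ring; rewrite <- H; ring. Qed.

Lemma minv_adj (A : M2) : mdet A = 1 -> minv A = adj A.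
Proof. intro H; unfold minv, adj; rewrite H; apply M2_eq; cbn; field. Qed.

Lemma mmul_mopp_r (A B : M2) : mmul A (mopp B) = mopp (mmul A B).
Proof. apply M2_eq; cbn; ring. Qed.

Lemma mopp_mopp (A : M2) : mopp (mopp A) = A.
Proof. apply M2_eq; cbn; ring. Qed.

(** * Continuity *)

Lemma mdist_refl (A : M2) : mdist A A = 0.
Proof. unfold mdist; rewrite !Rminus_diag, Rabs_R0; ring. Qed.

Lemma mdist_sym (A B : M2) : mdist A B = mdist B A.
Proof.
unfold mdist; rewrite (Rabs_minus_sym (m11 A)), (Rabs_minus_sym (m12 A)),
  (Rabs_minus_sym (m21 A)), (Rabs_minus_sym (m22 A)); reflexivity.
Qed.

Lemma Rabs_tri3 (x y z : R) : Rabs (x - z) <= Rabs (x - y) + Rabs (y - z).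
Proof. replace (x - z) with ((x - y) + (y - z)) by ring; apply Rabs_triang. Qed.

Lemma mdist_tri (A B C : M2) : mdist A C <= mdist A B + mdist B C.
Proof.
unfold mdist.
pose proof (Rabs_tri3 (m11 A) (m11 B) (m11 C)).
pose proof (Rabs_tri3 (m12 A) (m12 B) (m12 C)).
pose proof (Rabs_tri3 (m21 A) (m21 B) (m21 C)).
pose proof (Rabs_tri3 (m22 A) (m22 B) (m22 C)).
lra.
Qed.

Lemma mdist_mopp (A B : M2) : mdist (mopp A) (mopp B) = mdist A B.
Proof.
unfold mdist; cbn.
rewrite <- (Rabs_Ropp (m11 A - _)), <- (Rabs_Ropp (m12 A - _)),
  <- (Rabs_Ropp (m21 A - _)), <- (Rabs_Ropp (m22 A - _)).
repeat f_equal; ring.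
Qed.

Definition cont (f : M2 -> R) : Prop :=
  forall A e, 0 < e -> exists d, 0 < d /\
    forall B, mdist A B < d -> Rabs (f B - f A) < e.

Definition contM (T : M2 -> M2) : Prop :=
  cont (fun A => m11 (T A)) /\ cont (fun A => m12 (T A)) /\
  cont (fun A => m21 (T A)) /\ cont (fun A => m22 (T A)).

Lemma cont_const (c : R) : cont (fun _ => c).
Proof. intros A e He; exists 1; split; [lra|]; intros; rewrite Rminus_diag, Rabs_R0; lra. Qed.

Lemma cont_proj :
  cont (fun A => m11 A) /\ cont (fun A => m12 A) /\
  cont (fun A => m21 A) /\ cont (fun A => m22 A).
Proof.
repeat split; intros A e He; exists e; (split; [exact He|]); intros B HB;
  unfold mdist in HB; rewrite Rabs_minus_sym;
  pose proof (Rabs_pos (m11 A - m11 B)); pose proof (Rabs_pos (m12 A - m12 B));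
  pose proof (Rabs_pos (m21 A - m21 B)); pose proof (Rabs_pos (m22 A - m22 B)); lra.
Qed.

Lemma cont_m11 : cont m11. Proof. apply cont_proj. Qed.
Lemma cont_m12 : cont m12. Proof. apply cont_proj. Qed.
Lemma cont_m21 : cont m21. Proof. apply cont_proj. Qed.
Lemma cont_m22 : cont m22. Proof. apply cont_proj. Qed.

Lemma cont_comp (g : R -> R) (f : M2 -> R) :
  (forall A, continuity_pt g (f A)) -> cont f -> cont (fun A => g (f A)).
Proof.
intros Hg Hf A e He.
destruct (Hg A e He) as [d [Hd H]].
destruct (Hf A d Hd) as [d' [Hd' H']].
exists d'; split; [exact Hd'|]; intros B HB.
destruct (Req_dec (f B) (f A)) as [E|N].
- rewrite E, Rminus_diag, Rabs_R0; exact He.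
- apply (H (f B)); split; [split; [exact Logic.I | now apply not_eq_sym] | exact (H' B HB)].
Qed.

Lemma cont_plus (f g : M2 -> R) : cont f -> cont g -> cont (fun A => f A + g A).
Proof.
intros Hf Hg A e He.
destruct (Hf A (e / 2)) as [d1 [H1 K1]]; [lra|].
destruct (Hg A (e / 2)) as [d2 [H2 K2]]; [lra|].
exists (Rmin d1 d2); split; [now apply Rmin_pos|]; intros B HB.
pose proof (Rmin_l d1 d2); pose proof (Rmin_r d1 d2).
specialize (K1 B ltac:(lra)); specialize (K2 B ltac:(lra)).
replace (f B + g B - (f A + g A)) with ((f B - f A) + (g B - g A)) by ring.
eapply Rle_lt_trans; [apply Rabs_triang | lra].
Qed.

Lemma cont_scal (c : R) (f : M2 -> R) : cont f -> cont (fun A => c * f A).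
Proof.
intro Hf; apply (cont_comp (fun x => c * x)); [|exact Hf].
intro A; apply derivable_continuous_pt; reg.
Qed.

Lemma cont_opp (f : M2 -> R) : cont f -> cont (fun A => - f A).
Proof.
intro Hf; apply (cont_comp (fun x => - x)); [|exact Hf].
intro A; apply derivable_continuous_pt; reg.
Qed.

Lemma cont_minus (f g : M2 -> R) : cont f -> cont g -> cont (fun A => f A - g A).
Proof. intros Hf Hg; apply cont_plus; [exact Hf | now apply cont_opp]. Qed.

Lemma cont_ext (f g : M2 -> R) : (forall A, f A = g A) -> cont f -> cont g.
Proof.
intros E Hf A e He; destruct (Hf A e He) as [d [Hd H]].
exists d; split; [exact Hd|]; intros B HB; rewrite <- !E; auto.
Qed.

(* Polarization reduces products to squares, hence to composition. *)
Lemma cont_mult (f g : M2 -> R) : cont f -> cont g -> cont (fun A => f A * g A).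
Proof.
intros Hf Hg.
assert (S : forall h, cont h -> cont (fun A => h A * h A)).
{ intros h Hh; apply (cont_comp (fun x => x * x)); [|exact Hh].
  intro A; apply derivable_continuous_pt; reg. }
apply (cont_ext (fun A => / 4 * ((f A + g A) * (f A + g A) - (f A - g A) * (f A - g A)))).
{ intro A; field. }
apply cont_scal, cont_minus; apply S; [now apply cont_plus | now apply cont_minus].
Qed.

Lemma cont_abs (f : M2 -> R) : cont f -> cont (fun A => Rabs (f A)).
Proof. intro Hf; apply (cont_comp Rabs); [intro; apply Rcontinuity_abs | exact Hf]. Qed.

Lemma cont_sqrt (f : M2 -> R) :
  (forall A, 0 <= f A) -> cont f -> cont (fun A => sqrt (f A)).
Proof. intros P Hf; apply (cont_comp sqrt); [intro; now apply continuity_pt_sqrt | exact Hf]. Qed.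

Lemma contM_dist (T : M2 -> M2) : contM T ->
  forall A e, 0 < e -> exists d, 0 < d /\
    forall B, mdist A B < d -> mdist (T A) (T B) < e.
Proof.
intros (H1 & H2 & H3 & H4) A e He.
destruct (H1 A (e / 4)) as [d1 [D1 K1]]; [lra|].
destruct (H2 A (e / 4)) as [d2 [D2 K2]]; [lra|].
destruct (H3 A (e / 4)) as [d3 [D3 K3]]; [lra|].
destruct (H4 A (e / 4)) as [d4 [D4 K4]]; [lra|].
exists (Rmin (Rmin d1 d2) (Rmin d3 d4)); split; [repeat apply Rmin_pos; auto|].
intros B HB.
pose proof (Rmin_l (Rmin d1 d2) (Rmin d3 d4)); pose proof (Rmin_r (Rmin d1 d2) (Rmin d3 d4)).
pose proof (Rmin_l d1 d2); pose proof (Rmin_r d1 d2).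
pose proof (Rmin_l d3 d4); pose proof (Rmin_r d3 d4).
specialize (K1 B ltac:(lra)); specialize (K2 B ltac:(lra)).
specialize (K3 B ltac:(lra)); specialize (K4 B ltac:(lra)).
cbv beta in *; rewrite mdist_sym; unfold mdist; lra.
Qed.

Lemma contM_mmul (T U : M2 -> M2) : contM T -> contM U -> contM (fun A => mmul (T A) (U A)).
Proof.
intros (? & ? & ? & ?) (? & ? & ? & ?).
repeat split; cbn; apply cont_plus; now apply cont_mult.
Qed.

Lemma contM_const (C : M2) : contM (fun _ => C).
Proof. repeat split; apply cont_const. Qed.

Lemma contM_id : contM (fun A => A).
Proof. exact cont_proj. Qed.

Lemma contM_adj (T : M2 -> M2) : contM T -> contM (fun A => adj (T A)).
Proof. intros (? & ? & ? & ?); repeat split; cbn; try apply cont_opp; assumption. Qed.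

Lemma cont_compM (f : M2 -> R) (T : M2 -> M2) : cont f -> contM T -> cont (fun A => f (T A)).
Proof.
intros Hf HT A e He; destruct (Hf (T A) e He) as [d [Hd H]].
destruct (contM_dist T HT A d Hd) as [d' [Hd' H']].
exists d'; split; auto.
Qed.

Definition contP (g : R -> M2) (t : R) : Prop :=
  continuity_pt (fun s => m11 (g s)) t /\ continuity_pt (fun s => m12 (g s)) t /\
  continuity_pt (fun s => m21 (g s)) t /\ continuity_pt (fun s => m22 (g s)) t.

Lemma continuity_pt_dist (f : R -> R) (t e : R) : continuity_pt f t -> 0 < e ->
  exists d, 0 < d /\ forall s, Rabs (s - t) < d -> Rabs (f s - f t) < e.
Proof.
intros H He; destruct (H e He) as [d [Hd K]]; exists d; split; [exact Hd|]; intros s Hs.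
destruct (Req_dec s t) as [->|N].
- rewrite Rminus_diag, Rabs_R0; exact He.
- apply (K s); split; [split; [exact Logic.I | now apply not_eq_sym] | exact Hs].
Qed.

Lemma contP_dist (g : R -> M2) (t e : R) : contP g t -> 0 < e ->
  exists d, 0 < d /\ forall s, Rabs (s - t) < d -> mdist (g t) (g s) < e.
Proof.
intros (H1 & H2 & H3 & H4) He.
destruct (continuity_pt_dist _ t (e / 4) H1) as [d1 [D1 K1]]; [lra|].
destruct (continuity_pt_dist _ t (e / 4) H2) as [d2 [D2 K2]]; [lra|].
destruct (continuity_pt_dist _ t (e / 4) H3) as [d3 [D3 K3]]; [lra|].
destruct (continuity_pt_dist _ t (e / 4) H4) as [d4 [D4 K4]]; [lra|].
exists (Rmin (Rmin d1 d2) (Rmin d3 d4)); split; [repeat apply Rmin_pos; auto|].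
intros s Hs.
pose proof (Rmin_l (Rmin d1 d2) (Rmin d3 d4)); pose proof (Rmin_r (Rmin d1 d2) (Rmin d3 d4)).
pose proof (Rmin_l d1 d2); pose proof (Rmin_r d1 d2).
pose proof (Rmin_l d3 d4); pose proof (Rmin_r d3 d4).
specialize (K1 s ltac:(lra)); specialize (K2 s ltac:(lra)).
specialize (K3 s ltac:(lra)); specialize (K4 s ltac:(lra)).
cbv beta in *; rewrite mdist_sym; unfold mdist; lra.
Qed.

Lemma contP_comp (f : M2 -> R) (g : R -> M2) (t : R) :
  cont f -> contP g t -> continuity_pt (fun s => f (g s)) t.
Proof.
intros Hf Hg e He; destruct (Hf (g t) e He) as [d [Hd H]].
destruct (contP_dist g t d Hg Hd) as [d' [Hd' H']].
exists d'; split; [exact Hd'|]; intros s [_ Hs]; apply H, H', Hs.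
Qed.

(** Connectedness of [0, 1], through the supremum of the x such that [P] holds on all of [0, x]. It
    is applied to membership in an open set and to [half_in] along a path. *)
Lemma clopen_interval (P : R -> Prop) :
  (forall t, 0 <= t <= 1 -> P t ->
     exists d, 0 < d /\ forall s, 0 <= s <= 1 -> Rabs (s - t) < d -> P s) ->
  (forall t, 0 <= t <= 1 -> ~ P t ->
     exists d, 0 < d /\ forall s, 0 <= s <= 1 -> Rabs (s - t) < d -> ~ P s) ->
  P 0 -> P 1.
Proof.
intros Ho Hc P0.
set (E := fun x => 0 <= x <= 1 /\ forall s, 0 <= s <= x -> P s).
destruct (completeness E) as [m [Hub Hl]].
- exists 1; intros x [Hx _]; lra.
- exists 0; split; [lra|]; intros s Hs; now replace s with 0 by lra.
- assert (Hm : 0 <= m <= 1).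
  { split; [apply Hub; split; [lra|]; intros s Hs; now replace s with 0 by lra|].
    apply Hl; intros x [Hx _]; lra. }
  assert (Hlt : forall s, 0 <= s < m -> P s).
  { intros s Hs; apply Classical_Prop.NNPP; intro Hn.
    assert (m <= s); [|lra].
    apply Hl; intros x [Hx Hx']; destruct (Rle_lt_dec x s); [assumption|].
    exfalso; apply Hn, Hx'; lra. }
  assert (Pm : P m).
  { apply Classical_Prop.NNPP; intro Hn.
    destruct (Hc m Hm Hn) as [d [Hd H]].
    destruct (Req_dec m 0) as [->|Hm0]; [auto|].
    pose proof (Rmax_l 0 (m - d / 2)); pose proof (Rmax_r 0 (m - d / 2)).
    assert (Rmax 0 (m - d / 2) < m) by (apply Rmax_lub_lt; lra).
    apply (H (Rmax 0 (m - d / 2))); [lra | apply Rabs_def1; lra | apply Hlt; lra]. }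
  destruct (Req_dec m 1) as [->|Hm1]; [exact Pm|].
  destruct (Ho m Hm Pm) as [d [Hd H]].
  pose proof (Rmin_l 1 (m + d / 2)); pose proof (Rmin_r 1 (m + d / 2)).
  assert (m < Rmin 1 (m + d / 2)) by (apply Rmin_glb_lt; lra).
  assert (Rmin 1 (m + d / 2) <= m); [|lra].
  apply Hub; split; [lra|]; intros s Hs.
  destruct (Rlt_le_dec s m); [apply Hlt; lra|].
  apply H; [lra | apply Rabs_def1; lra].
Qed.

Lemma pow2_gt_0 (x : R) : x <> 0 -> 0 < x ^ 2.
Proof. intro H; destruct (Rdichotomy _ _ H); nra. Qed.

(** * The separating function of a crooked plane *)

(* sgn t * sqrt (max 0 (t^2 - 4)), written as a sum of two continuous terms. *)
Definition sigma (t : R) : R :=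
  sqrt (Rmax 0 (t - 2) * (Rabs t + 2)) - sqrt (Rmax 0 (- t - 2) * (Rabs t + 2)).

Lemma sigma_spec (t : R) :
  (t ^ 2 <= 4 /\ sigma t = 0) \/
  (4 <= t ^ 2 /\ sigma t ^ 2 = t ^ 2 - 4 /\ 0 <= t * sigma t).
Proof.
unfold sigma.
destruct (Rle_lt_dec t 2) as [H2|H2]; [destruct (Rle_lt_dec (-2) t) as [H1|H1]|].
- left; split; [nra|].
  rewrite !Rmax_left by lra; rewrite !Rmult_0_l, sqrt_0; ring.
- right; rewrite Rmax_left, Rmax_right, (Rabs_left t) by lra.
  rewrite Rmult_0_l, sqrt_0.
  assert (P : 0 <= (- t - 2) * (- t + 2)) by nra.
  pose proof (sqrt_sqrt _ P); pose proof (sqrt_pos ((- t - 2) * (- t + 2))).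
  split; [nra|split; nra].
- right; rewrite Rmax_right, Rmax_left, (Rabs_right t) by lra.
  rewrite Rmult_0_l, sqrt_0.
  assert (P : 0 <= (t - 2) * (t + 2)) by nra.
  pose proof (sqrt_sqrt _ P); pose proof (sqrt_pos ((t - 2) * (t + 2))).
  split; [nra|split; nra].
Qed.

Lemma sigma_opp (t : R) : sigma (- t) = - sigma t.
Proof. unfold sigma; rewrite Rabs_Ropp, Ropp_involutive; ring. Qed.

(* On PSL_2(R) minus the identity, [sep h] has the sign of the real part of the
   nonrepelling fixed point of [h], i.e. of its side of the geodesic from 0 to oo. *)
Definition sep (h : M2) : R :=
  (m21 h - m12 h) * (m11 h - m22 h) + (m12 h + m21 h) * sigma (m11 h + m22 h).

Lemma cont_sep : cont sep.
Proof.
assert (M : forall f, cont f -> cont (fun A => Rmax 0 (f A))).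
{ intros f Hf; apply (cont_ext (fun A => / 2 * (f A + Rabs (f A)))).
  - intro A; unfold Rmax, Rabs; destruct (Rle_dec 0 (f A)), (Rcase_abs (f A)); lra.
  - apply cont_scal, cont_plus; [|apply cont_abs]; exact Hf. }
assert (Q : forall x t, 0 <= Rmax 0 x * (Rabs t + 2)).
{ intros x t; apply Rmult_le_pos; [apply Rmax_l | pose proof (Rabs_pos t); lra]. }
unfold sep, sigma.
repeat first [ apply cont_m11 | apply cont_m12 | apply cont_m21 | apply cont_m22
  | apply cont_const | apply cont_plus | apply cont_minus | apply cont_opp
  | apply cont_mult | apply cont_sqrt | apply M | apply cont_abs | intro; apply Q ].
Qed.

Lemma sep_mopp (h : M2) : sep (mopp h) = sep h.
Proof.
unfold sep; cbn.
replace (- m11 h + - m22 h) with (- (m11 h + m22 h)) by ring.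
rewrite sigma_opp; ring.
Qed.

(** Conjugation by the reflection in the unit circle: it exchanges the endpoints 0 and oo of the
    geodesic and keeps its sides. *)
Definition swap (h : M2) : M2 := mkM2 (m22 h) (m21 h) (m12 h) (m11 h).

Lemma sep_swap (h : M2) : sep (swap h) = sep h.
Proof. unfold sep; cbn; rewrite (Rplus_comm (m22 h)); ring. Qed.

(** Conjugation by the reflection in the geodesic from 0 to oo itself, which exchanges the sides. *)
Definition flip (h : M2) : M2 := mkM2 (m11 h) (- m12 h) (- m21 h) (m22 h).

Lemma sep_flip (h : M2) : sep (flip h) = - sep h.
Proof. unfold sep; cbn; ring. Qed.

(** The quadratic relation is det h = 1 in the coordinates p = a - d, q = c - b, r = b + c, t = a +
    d. Where sigma^2 = t^2 - 4 it reads p^2 - sigma^2 = q^2 - r^2, so comparing q^2 with r^2 decides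
    which of the terms p q and r sigma dominates and gives the sign of the sum. *)
Lemma quad_pos_1 (p q r t : R) : t ^ 2 + q ^ 2 = p ^ 2 + r ^ 2 + 4 ->
  0 < p * q -> r ^ 2 < q ^ 2 -> 0 < p * q + r * sigma t.
Proof.
intros E H1 H2.
destruct (sigma_spec t) as [[_ ->]|(H4 & Hs & _)]; [lra|].
assert (K : (r * sigma t) ^ 2 < (p * q) ^ 2).
{ replace ((r * sigma t) ^ 2) with (r ^ 2 * (sigma t ^ 2)) by ring; rewrite Hs.
  replace ((p * q) ^ 2) with (q ^ 2 * p ^ 2) by ring.
  assert (p <> 0) by (intros ->; lra).
  assert (0 < p ^ 2) by nra.
  apply Rle_lt_trans with (r ^ 2 * p ^ 2).
  - apply Rmult_le_compat_l; [nra|lra].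
  - apply Rmult_lt_compat_r; assumption. }
nra.
Qed.

Lemma quad_pos_2 (p q r t : R) : t ^ 2 + q ^ 2 = p ^ 2 + r ^ 2 + 4 ->
  0 < r * t -> q ^ 2 < r ^ 2 -> 0 < p * q + r * sigma t.
Proof.
intros E H1 H2.
destruct (sigma_spec t) as [[H4 _]|(H4 & Hs & Hp)]; [nra|].
assert (Hp' : 0 < t * sigma t).
{ assert (sigma t <> 0) by (intros Z; rewrite Z in Hs; nra).
  assert (t <> 0) by (intros ->; lra).
  assert (t * sigma t <> 0) by (now apply Rmult_integral_contrapositive_currified).
  lra. }
assert (P : 0 < r * sigma t).
{ apply Rmult_lt_reg_l with (t ^ 2); [nra|].
  replace (t ^ 2 * (r * sigma t)) with ((r * t) * (t * sigma t)) by ring.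
  rewrite Rmult_0_r; now apply Rmult_lt_0_compat. }
assert (K : (p * q) ^ 2 < (r * sigma t) ^ 2).
{ replace ((r * sigma t) ^ 2) with (r ^ 2 * (sigma t ^ 2)) by ring; rewrite Hs.
  replace ((p * q) ^ 2) with (q ^ 2 * p ^ 2) by ring.
  apply Rle_lt_trans with (q ^ 2 * (t ^ 2 - 4)).
  - apply Rmult_le_compat_l; nra.
  - apply Rmult_lt_compat_r; nra. }
nra.
Qed.

Lemma quad_pos_3 (p q r t : R) : t ^ 2 + q ^ 2 = p ^ 2 + r ^ 2 + 4 ->
  0 < p * q -> 0 < r * t -> 0 < p * q + r * sigma t.
Proof.
intros E H1 H2.
destruct (Rtotal_order (r ^ 2) (q ^ 2)) as [L|[L|L]].
- now apply quad_pos_1.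
- assert (0 <= r * sigma t); [|lra].
  destruct (sigma_spec t) as [[H4 ->]|(H4 & Hs & Hp)]; [lra|].
  apply Rmult_le_reg_l with (t ^ 2).
  + assert (t <> 0) by (intros ->; lra); nra.
  + replace (t ^ 2 * (r * sigma t)) with ((r * t) * (t * sigma t)) by ring.
    rewrite Rmult_0_r; apply Rmult_le_pos; lra.
- now apply quad_pos_2.
Qed.

Lemma sep_quad (h : M2) : mdet h = 1 ->
  (m11 h + m22 h) ^ 2 + (m21 h - m12 h) ^ 2 =
  (m11 h - m22 h) ^ 2 + (m12 h + m21 h) ^ 2 + 4.
Proof. unfold mdet; intro; nra. Qed.

Lemma sep_pos (h : M2) : mdet h = 1 ->
  let p := m11 h - m22 h in let q := m21 h - m12 h in
  let r := m12 h + m21 h in let t := m11 h + m22 h in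
  (0 < p * q /\ r ^ 2 < q ^ 2) \/ (0 < r * t /\ q ^ 2 < r ^ 2) \/
  (0 < p * q /\ 0 < r * t) -> 0 < sep h.
Proof.
intros D p q r t H; pose proof (sep_quad h D) as E.
unfold sep; fold p q r t in E |- *; rewrite (Rmult_comm q p).
destruct H as [[]|[[]|[]]];
  [apply quad_pos_1 | apply quad_pos_2 | apply quad_pos_3]; assumption.
Qed.

(** The crooked plane of the geodesic from 0 to oo in matrix entries: the wing at oo, the wing at 0,
    and the stem of elliptic elements fixing a point i y. *)
Definition zero_form (h : M2) : Prop :=
  (m21 h = 0 /\ 1 <= Rabs (m11 h)) \/ (m12 h = 0 /\ 1 <= Rabs (m22 h)) \/
  (m11 h = m22 h /\ m12 h * m21 h < 0).

Lemma Rabs_ge1 (x : R) : 1 <= Rabs x <-> 1 <= x ^ 2.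
Proof. unfold Rabs; destruct (Rcase_abs x); split; intro; nra. Qed.

Lemma sep_wing (h : M2) : mdet h = 1 -> m21 h = 0 -> 1 <= Rabs (m11 h) -> sep h = 0.
Proof.
unfold mdet; intros D C A; apply Rabs_ge1 in A; unfold sep; rewrite C in *.
replace ((0 - m12 h) * (m11 h - m22 h) + (m12 h + 0) * sigma (m11 h + m22 h))
  with (m12 h * (sigma (m11 h + m22 h) - (m11 h - m22 h))) by ring.
set (a := m11 h) in *; set (d := m22 h) in *.
assert (ad : a * d = 1) by lra.
assert (d ^ 2 <= 1) by nra.
assert (sigma (a + d) = a - d); [|nra].
destruct (sigma_spec (a + d)) as [[H4 ->]|(H4 & Hs & Hp)].
- assert ((a - d) ^ 2 <= 0) by nra; nra.
- assert (K : (sigma (a + d) - (a - d)) * (sigma (a + d) + (a - d)) = 0) by nra.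
  destruct (Rmult_integral _ _ K) as [|K']; [lra|].
  replace (sigma (a + d)) with (- (a - d)) in Hp by lra.
  assert ((a - d) ^ 2 <= 0); [|nra].
  assert ((a+d) * (a-d) = 0) by nra.
  destruct (Rmult_integral _ _ H0); nra.
Qed.

Lemma mdet_swap (h : M2) : mdet (swap h) = mdet h.
Proof. unfold mdet; cbn; ring. Qed.

Lemma mdet_flip (h : M2) : mdet (flip h) = mdet h.
Proof. unfold mdet; cbn; ring. Qed.

(** If [sep h] vanishes, the criteria of [sep_pos] fail for h and for [flip h]. As q^2 - r^2 = - 4 b
    c, the sign of b c separates the cases: negative leaves the stem, zero the wings, and positive
    is impossible because then r and t are both nonzero. *)
Lemma sep_zero (h : M2) : mdet h = 1 -> (sep h = 0 <-> zero_form h).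
Proof.
intro D; split.
- intro Z.
  assert (N1 : ~ 0 < sep h) by lra.
  assert (N2 : ~ 0 < sep (flip h)) by (rewrite sep_flip; lra).
  assert (D' : mdet (flip h) = 1) by (now rewrite mdet_flip).
  assert (M1 := fun K => N1 (sep_pos h D K)).
  assert (M2 := fun K => N2 (sep_pos _ D' K)).
  pose proof (sep_quad h D) as E; unfold mdet in D; clear N1 N2 D'.
  unfold zero_form; rewrite !Rabs_ge1; unfold sep in Z; cbn [flip m11 m12 m21 m22] in *.
  set (a := m11 h) in *; set (b := m12 h) in *; set (c := m21 h) in *; set (d := m22 h) in *.
  destruct (Rtotal_order (b * c) 0) as [L|[L|L]].
  + right; right; split; [|lra].
    destruct (Rtotal_order ((a - d) * (c - b)) 0) as [L'|[L'|L']].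
    * exfalso; apply M2; left; split; [lra|]. nra.
    * destruct (Rmult_integral _ _ L'); nra.
    * exfalso; apply M1; left; split; [lra|]. nra.
  + assert (ad : a * d = 1) by lra.
    destruct (Rle_lt_dec 1 (a ^ 2)) as [A|A].
    * destruct (Req_dec c 0) as [|C]; [tauto|].
      destruct (Rmult_integral _ _ L) as [B|]; [|tauto].
      right; left; split; [assumption|].
      rewrite B in *.
      assert (Sg : (a - d) + sigma (a + d) = 0).
      { apply Rmult_eq_reg_l with c; [lra|assumption]. }
      destruct (sigma_spec (a + d)) as [[H4 Hs]|(H4 & Hs & Hp)]; nra.
    * assert (1 <= d ^ 2) by nra.
      destruct (Rmult_integral _ _ L) as [|C]; [tauto|].
      destruct (Req_dec b 0) as [|B]; [tauto|].
      left; split; [assumption|]; rewrite C in *.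
      assert (Sg : sigma (a + d) = a - d).
      { apply Rmult_eq_reg_l with b; [lra|assumption]. }
      destruct (sigma_spec (a + d)) as [[H4 Hs]|(H4 & Hs & Hp)]; nra.
  + assert (T : (b + c) * (a + d) <> 0).
    { apply Rmult_integral_contrapositive_currified; nra. }
    exfalso; destruct (Rdichotomy _ _ T).
    * apply M2; right; left; split; nra.
    * apply M1; right; left; split; nra.
- intros [[C A]|[[B E]|[A BC]]].
  + now apply sep_wing.
  + rewrite <- sep_swap; apply sep_wing; [now rewrite mdet_swap | exact B | exact E].
  + unfold sep; rewrite A, Rminus_diag.
    unfold mdet in D; rewrite A in D.
    destruct (sigma_spec (m22 h + m22 h)) as [[_ ->]|(H4 & _)]; [ring|nra].
Qed.

(** Hyperbolic translation along the geodesic from -1 to 1, which crosses the one from 0 to oo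
    orthogonally at i. The parameter is the hyperbolic sine of half the translation length, so that
    the entries stay algebraic. *)
Definition boost (s : R) : M2 := mkM2 (sqrt (1 + s ^ 2)) s s (sqrt (1 + s ^ 2)).

Lemma boost_sqrt (s : R) : sqrt (1 + s ^ 2) * sqrt (1 + s ^ 2) = 1 + s ^ 2.
Proof. apply sqrt_sqrt; nra. Qed.

Lemma mdet_boost (s : R) : mdet (boost s) = 1.
Proof. unfold mdet, boost; cbn [m11 m12 m21 m22]; rewrite boost_sqrt; ring. Qed.

Lemma boost_opp (s : R) : boost (- s) = adj (boost s).
Proof. unfold boost, adj; cbn [m11 m12 m21 m22]; replace ((- s) ^ 2) with (s ^ 2) by ring; reflexivity. Qed.

(* With p = a - d, q = c - b, r = b + c, t = a + d, left multiplication by a boost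
   acts on (p, q) and on (r, t) by hyperbolic rotations. *)
Lemma boost_quad_stem (q r t C S : R) : C ^ 2 = 1 + S ^ 2 -> 0 < C -> 0 < S ->
  t ^ 2 + q ^ 2 = r ^ 2 + 4 -> r ^ 2 < q ^ 2 ->
  let p' := q * S in let q' := q * C in
  let r' := r * C + t * S in let t' := t * C + r * S in
  0 < p' * q' /\ (r' ^ 2 < q' ^ 2 \/ 0 < r' * t').
Proof.
intros EC HC HS E L p' q' r' t'.
assert (SC : 0 < S * C) by now apply Rmult_lt_0_compat.
split.
- unfold p', q'; replace (q * S * (q * C)) with (q ^ 2 * (S * C)) by ring.
  apply Rmult_lt_0_compat; [nra|assumption].
- destruct (Rlt_le_dec 0 (r' * t')) as [|N]; [now right|left].
  assert (N' : r * t * (C ^ 2 + S ^ 2) + (t ^ 2 + r ^ 2) * (S * C) <= 0).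
  { unfold r', t' in N; nra. }
  (* Multiply [N'] by 2 S C and use C^2 + S^2 <= 2 C^2. *)
  assert (K : 2 * (r * t) * (S * C) <= - (t ^ 2 + r ^ 2) * S ^ 2).
  { apply Rmult_le_reg_l with (C ^ 2 + S ^ 2); [nra|].
    apply Rle_trans with (- 2 * (t ^ 2 + r ^ 2) * (S * C) * (S * C)).
    - pose proof (Rmult_le_compat_r _ _ _ (Rlt_le _ _ SC) N'); nra.
    - assert (0 <= t ^ 2 + r ^ 2) by nra.
      assert (0 <= (t ^ 2 + r ^ 2) * S ^ 2) by nra.
      replace (- 2 * (t ^ 2 + r ^ 2) * (S * C) * (S * C))
        with (((t ^ 2 + r ^ 2) * S ^ 2) * (- 2 * C ^ 2)) by ring.
      replace ((C ^ 2 + S ^ 2) * (- (t ^ 2 + r ^ 2) * S ^ 2))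
        with (((t ^ 2 + r ^ 2) * S ^ 2) * (- (C ^ 2 + S ^ 2))) by ring.
      apply Rmult_le_compat_l; [assumption|lra]. }
  unfold r', q'.
  assert (0 < (q ^ 2 - r ^ 2) * C ^ 2) by (apply Rmult_lt_0_compat; nra).
  replace ((r * C + t * S) ^ 2)
    with (r ^ 2 * C ^ 2 + t ^ 2 * S ^ 2 + 2 * (r * t) * (S * C)) by ring.
  assert (0 <= r ^ 2 * S ^ 2) by (apply Rmult_le_pos; nra).
  nra.
Qed.

(** On the wing at oo, q = - r. If r t >= 0, the boosted quadruple satisfies the second alternative.
    Otherwise r p <= 0, which makes p' q' positive, and either r' t' > 0 or the estimate [K] forces
    r'^2 < q'^2. *)
Lemma boost_quad_wing (p r t C S : R) : C ^ 2 = 1 + S ^ 2 -> 0 < C -> 0 < S ->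
  t ^ 2 = p ^ 2 + 4 -> 0 <= t * p ->
  let p' := p * C - r * S in let q' := - r * C + p * S in
  let r' := r * C + t * S in let t' := t * C + r * S in
  (0 < p' * q' /\ r' ^ 2 < q' ^ 2) \/ (0 < r' * t' /\ q' ^ 2 < r' ^ 2) \/
  (0 < p' * q' /\ 0 < r' * t').
Proof.
intros EC HC HS E TP p' q' r' t'.
assert (SC : 0 < S * C) by now apply Rmult_lt_0_compat.
assert (Er : r' * t' = r * t * (C ^ 2 + S ^ 2) + (t ^ 2 + r ^ 2) * (S * C))
  by (unfold r', t'; ring).
assert (Ep : p' * q' = - (p * r) * (C ^ 2 + S ^ 2) + (p ^ 2 + r ^ 2) * (S * C))
  by (unfold p', q'; ring).
assert (Ed : r' ^ 2 - q' ^ 2 = 4 * S ^ 2 + 2 * (r * (t + p)) * (S * C)).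
{ unfold r', q'.
  replace (4 * S ^ 2) with ((t ^ 2 - p ^ 2) * S ^ 2) by (rewrite E; ring); ring. }
assert (0 < t ^ 2) by nra.
assert (0 < S ^ 2) by nra.
assert (0 < C ^ 2 + S ^ 2) by nra.
destruct (Rle_lt_dec 0 (r * t)) as [RT|RT].
- right; left; split.
  + rewrite Er; apply Rplus_le_lt_0_compat; [apply Rmult_le_pos; lra|].
    apply Rmult_lt_0_compat; nra.
  + assert (0 <= r * (t + p)).
    { apply Rmult_le_reg_l with (t ^ 2); [assumption|].
      replace (t ^ 2 * (r * (t + p))) with ((r * t) * (t ^ 2 + t * p)) by ring.
      rewrite Rmult_0_r; apply Rmult_le_pos; lra. }
    assert (0 <= 2 * (r * (t + p)) * (S * C)) by (apply Rmult_le_pos; lra).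
    lra.
- assert (RP : r * p <= 0).
  { apply Rmult_le_reg_l with (t ^ 2); [assumption|].
    replace (t ^ 2 * (r * p)) with ((r * t) * (t * p)) by ring.
    rewrite Rmult_0_r; nra. }
  assert (P' : 0 < p' * q').
  { rewrite Ep; apply Rplus_le_lt_0_compat; [apply Rmult_le_pos; lra|].
    apply Rmult_lt_0_compat; [|assumption].
    assert (r <> 0) by (intros ->; lra). nra. }
  destruct (Rlt_le_dec 0 (r' * t')) as [|N]; [now right; right|left].
  split; [exact P'|].
  rewrite Er in N.
  assert (K : 2 * (r * t) * (S * C) <= - (t ^ 2 + r ^ 2) * S ^ 2).
  { apply Rmult_le_reg_l with (C ^ 2 + S ^ 2); [nra|].
    apply Rle_trans with (- 2 * (t ^ 2 + r ^ 2) * (S * C) * (S * C)).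
    - pose proof (Rmult_le_compat_r _ _ _ (Rlt_le _ _ SC) N); nra.
    - assert (0 <= (t ^ 2 + r ^ 2) * S ^ 2) by nra.
      replace (- 2 * (t ^ 2 + r ^ 2) * (S * C) * (S * C))
        with (((t ^ 2 + r ^ 2) * S ^ 2) * (- 2 * C ^ 2)) by ring.
      replace ((C ^ 2 + S ^ 2) * (- (t ^ 2 + r ^ 2) * S ^ 2))
        with (((t ^ 2 + r ^ 2) * S ^ 2) * (- (C ^ 2 + S ^ 2))) by ring.
      apply Rmult_le_compat_l; [assumption|lra]. }
  assert (0 < r ^ 2 * S ^ 2) by (apply Rmult_lt_0_compat; nra).
  assert (2 * (r * p) * (S * C) <= 0) by nra.
  assert (4 * S ^ 2 <= t ^ 2 * S ^ 2) by (apply Rmult_le_compat_r; nra).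
  nra.
Qed.

Lemma boost_pos (h : M2) (s : R) :
  mdet h = 1 -> sep h = 0 -> 0 < s -> 0 < sep (mmul (boost s) h).
Proof.
assert (C1 := boost_sqrt s).
assert (C0 : 0 < sqrt (1 + s ^ 2)) by (apply sqrt_lt_R0; nra).
assert (C2 : sqrt (1 + s ^ 2) ^ 2 = 1 + s ^ 2) by (rewrite <- Rsqr_pow2; exact C1).
assert (W : forall h, mdet h = 1 -> m21 h = 0 -> 1 <= m11 h ^ 2 -> 0 < s ->
            0 < sep (mmul (boost s) h)).
{ clear h; intros h D C A Hs.
  apply sep_pos; [rewrite mdet_mmul, mdet_boost, D; ring|].
  unfold mdet in D.
  pose proof (boost_quad_wing (m11 h - m22 h) (m12 h) (m11 h + m22 h) _ s C2 C0 Hs) as B.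
  cbv zeta in B |- *; unfold boost, mmul; cbn [m11 m12 m21 m22].
  set (K := sqrt (1 + s ^ 2)) in *; rewrite C in *.
  destruct h as [a b c d]; cbn [m11 m12 m21 m22] in *.
  replace (K * a + s * 0 - (s * b + K * d)) with ((a - d) * K - b * s) by ring.
  replace (s * a + K * 0 - (K * b + s * d)) with (- b * K + (a - d) * s) by ring.
  replace (K * b + s * d + (s * a + K * 0)) with (b * K + (a + d) * s) by ring.
  replace (K * a + s * 0 + (s * b + K * d)) with ((a + d) * K + b * s) by ring.
  apply B; nra. }
intros D Z Hs.
apply (sep_zero h D) in Z; destruct Z as [[C A]|[[B E]|[A BC]]].
- apply W; auto; now apply Rabs_ge1.
(* Boosts are fixed by [swap], so the wing at 0 reduces to the wing at oo. *)
- rewrite <- sep_swap.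
  replace (swap (mmul (boost s) h)) with (mmul (boost s) (swap h))
    by (apply M2_eq; cbn -[sqrt pow]; ring).
  apply W; auto; [now rewrite mdet_swap | now apply Rabs_ge1].
- apply sep_pos; [rewrite mdet_mmul, mdet_boost, D; ring|].
  unfold mdet in D.
  pose proof (boost_quad_stem (m21 h - m12 h) (m12 h + m21 h) (m11 h + m22 h) _ s C2 C0 Hs) as B.
  cbv zeta in B |- *; unfold boost, mmul; cbn [m11 m12 m21 m22].
  set (K := sqrt (1 + s ^ 2)) in *; rewrite A in *.
  destruct h as [a b c d]; cbn [m11 m12 m21 m22] in *.
  replace (K * d + s * c - (s * b + K * d)) with ((c - b) * s) by ring.
  replace (s * d + K * c - (K * b + s * d)) with ((c - b) * K) by ring.
  replace (K * b + s * d + (s * d + K * c)) with ((b + c) * K + (d + d) * s) by ring.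
  replace (K * d + s * c + (s * b + K * d)) with ((d + d) * K + (b + c) * s) by ring.
  destruct B as [B1 [B2|B2]]; [nra|nra|left|right; right]; split; assumption.
Qed.

Lemma boost_sep (h : M2) (s : R) :
  mdet h = 1 -> sep h = 0 -> s <> 0 -> 0 < s * sep (mmul (boost s) h).
Proof.
intros D Z Hs; destruct (Rdichotomy _ _ Hs) as [L|L].
- assert (P : 0 < sep (mmul (boost (- s)) (flip h))).
  { apply boost_pos; [now rewrite mdet_flip | rewrite sep_flip, Z; ring | lra]. }
  replace (mmul (boost (- s)) (flip h)) with (flip (mmul (boost s) h)) in P.
  + rewrite sep_flip in P; nra.
  + rewrite boost_opp; apply M2_eq; cbn -[sqrt pow]; ring.
- pose proof (boost_pos h s D Z L); nra.
Qed.

(** The eigenvector (w, 2 c) with w = a - d + sigma has w of the sign of the trace, so the side of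
    the nonrepelling fixed point is the sign of c (a + d). Multiplying [sep] by w turns this into an
    identity whose remainder vanishes by sigma^2 = t^2 - 4 and det = 1. *)
Lemma sep_wing_sign (m : M2) (e : R) : mdet m = 1 -> m22 m ^ 2 < m11 m ^ 2 ->
  4 <= (m11 m + m22 m) ^ 2 -> 0 < e * (m21 m * (m11 m + m22 m)) -> 0 < e * sep m.
Proof.
unfold mdet, sep; intros D A T K.
set (a := m11 m) in *; set (b := m12 m) in *; set (c := m21 m) in *; set (d := m22 m) in *.
assert (Sg : sigma (a + d) ^ 2 = (a + d) ^ 2 - 4 /\ 0 <= (a + d) * sigma (a + d)).
{ destruct (sigma_spec (a + d)) as [[H4 ->]|(_ & Hs & Hp)]; [|tauto].
  split; [|lra]; replace ((a + d) ^ 2) with 4 by lra; ring. }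
destruct Sg as [Hs Hp].
set (w := (a - d) + sigma (a + d)).
assert (P1 : 0 < (a + d) * w) by (unfold w; nra).
apply Rmult_lt_reg_l with ((a + d) * w); [exact P1|].
replace ((a + d) * w * (e * ((c - b) * (a - d) + (b + c) * sigma (a + d))))
  with ((e * (c * (a + d))) * (w ^ 2 + 4 * b ^ 2)
        + e * (a + d) * b * (sigma (a + d) ^ 2 - (a + d) ^ 2 + 4 * (a * d - b * c)))
  by (unfold w; ring).
rewrite Hs, D, Rmult_0_r.
apply Rplus_lt_le_0_compat; [|right; ring].
apply Rmult_lt_0_compat; [exact K|].
assert (w <> 0) by (intros Z; rewrite Z in P1; lra).
nra.
Qed.

(** * Fixed points and geodesics *)

(** x + i y and its conjugate are the roots of c z^2 + (d - a) z - b. The right-hand side gives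
    their sum and product, multiplied by c so that the identity, where c = 0, is covered. *)
Lemma mob_HP_fixed (h : M2) (x y : R) : mdet h = 1 -> 0 < y ->
  (mob h (HP x y) = HP x y <->
   m11 h - m22 h = 2 * m21 h * x /\ m12 h = - m21 h * (x ^ 2 + y ^ 2)).
Proof.
intros D Hy; unfold mob; rewrite D; unfold mdet in D.
destruct h as [a b c d]; cbn [m11 m12 m21 m22] in *.
set (N := (c * x + d) ^ 2 + (c * y) ^ 2).
assert (N0 : 0 < N).
{ unfold N; destruct (Req_dec c 0) as [C|C].
  - assert (d <> 0) by (intro Z; rewrite C, Z in D; lra); rewrite C.
    pose proof (pow2_gt_0 d H); nra.
  - assert (c * y <> 0) by (apply Rmult_integral_contrapositive_currified; first [assumption | apply Rgt_not_eq; nra]).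
    pose proof (pow2_gt_0 _ H); pose proof (pow2_ge_0 (c * x + d)); lra. }
split.
- intro H; injection H as H1 H2.
  (* Comparing imaginary parts gives |c z + d| = 1. *)
  assert (N1 : N = 1).
  { apply Rmult_eq_reg_l with (y / N).
    - replace (y / N * N) with y by (field; lra). rewrite Rmult_1_r; lra.
    - assert (0 < y / N) by (apply Rdiv_lt_0_compat; lra). lra. }
  rewrite N1, Rdiv_1_r in H1; unfold N in N1.
  (* Entries of the conjugate by the translation taking x to 0, whose fixed point is i y. *)
  set (a1 := a - x * c) in *; set (d1 := c * x + d) in *.
  set (b1 := a * x + b - x * d1) in *.
  assert (E1 : b1 * d1 + a1 * c * y ^ 2 = 0).
  { replace (b1 * d1 + a1 * c * y ^ 2) with
      ((a * x + b) * d1 + a * c * y ^ 2 - x * (d1 ^ 2 + (c * y) ^ 2)) by (unfold b1, a1; ring).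
    rewrite N1; lra. }
  assert (E2 : a1 * d1 - b1 * c = 1) by (unfold a1, b1, d1; lra).
  assert (E3 : a1 = d1).
  { replace a1 with (a1 * (d1 ^ 2 + (c * y) ^ 2)) by (rewrite N1; ring).
    replace (a1 * (d1 ^ 2 + (c * y) ^ 2))
      with (d1 * (a1 * d1 - b1 * c) + c * (b1 * d1 + a1 * c * y ^ 2)) by ring.
    rewrite E1, E2; ring. }
  rewrite E3 in *.
  assert (E4 : b1 = - c * y ^ 2).
  { replace b1 with (b1 * (d1 ^ 2 + (c * y) ^ 2)) by (rewrite N1; ring).
    replace (b1 * (d1 ^ 2 + (c * y) ^ 2))
      with (d1 * (b1 * d1 + d1 * c * y ^ 2) - c * y ^ 2 * (d1 * d1 - b1 * c)) by ring.
    rewrite E1, E2; ring. }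
  split; unfold a1, d1 in E3; [lra|].
  assert (a = d1 + x * c) by (unfold d1; lra).
  unfold b1 in E4. rewrite H in E4. nra.
- intros [H1 H2].
  assert (a = d + 2 * c * x) by lra. subst a b.
  assert (N1 : N = 1) by (unfold N; rewrite <- D; ring).
  rewrite N1; f_equal; [|field].
  rewrite Rdiv_1_r.
  transitivity (x * ((d + 2 * c * x) * d - - c * (x ^ 2 + y ^ 2) * c)); [ring|].
  rewrite D; ring.
Qed.

Lemma mob_BP_fixed (h : M2) (x : R) :
  (mob h (BP x) = BP x /\ 1 <= Rabs (m21 h * x + m22 h)) <->
  (m11 h * x + m12 h = x * (m21 h * x + m22 h) /\ 1 <= Rabs (m21 h * x + m22 h)).
Proof.
unfold mob; destruct (Req_EM_T (m21 h * x + m22 h) 0) as [E|N].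
- rewrite E, Rabs_R0; split; intros [_ ?]; lra.
- split; intros [H K]; (split; [|exact K]).
  + injection H as H; rewrite <- H at 2; field; exact N.
  + f_equal; rewrite H; field; exact N.
Qed.

Lemma mob_Inf_fixed (h : M2) : mob h Inf = Inf <-> m21 h = 0.
Proof. unfold mob; destruct (Req_EM_T (m21 h) 0); split; intro; congruence. Qed.

(* The frame f maps 0 and oo to the endpoints of the geodesic. *)
Lemma Cset_frame (l : geod) : geod_valid l -> exists f, mdet f = 1 /\
  forall h, mdet h = 1 -> (Cset l h <-> zero_form (mmul (mmul (adj f) h) f)).
Proof.
destruct l as [e|m r]; cbn [geod_valid]; intro V.
- exists (mkM2 1 e 0 1); split; [unfold mdet; cbn; ring|].
  intros h D; unfold zero_form, adj, mmul; cbn [m11 m12 m21 m22].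
  split.
  + intros (_ & p & Hp & Hl & Hf & Hr).
    destruct p as [x y|x|]; cbn [in_Hbar in_geod_closure] in Hp, Hl.
    * destruct Hl as [-> _].
      apply mob_HP_fixed in Hf; [|assumption|assumption].
      destruct Hf as [H1 H2]; unfold mdet in D.
      destruct h as [a b c d]; cbn [m11 m12 m21 m22] in *.
      destruct (Req_dec c 0) as [->|C].
      -- left; split; [ring|]; apply Rabs_ge1.
         assert (a = d) by lra; subst. nra.
      -- right; right; split; [lra|].
         assert (a = d + 2 * c * e) by lra; subst a b.
         assert (0 < c ^ 2 * y ^ 2) by (apply Rmult_lt_0_compat; apply pow2_gt_0; first [assumption | apply Rgt_not_eq; nra]).
         nra.
    * subst x. destruct (proj1 (mob_BP_fixed h e) (conj Hf Hr)) as [H1 _].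
      right; left; split; [lra|].
      replace ((1 - 1) * 1) with 0 by ring.
      eapply Rle_trans; [exact Hr|right; f_equal; ring].
    * apply mob_Inf_fixed in Hf; left; rewrite Hf in *; split; [ring|].
      eapply Rle_trans; [exact Hr|right; f_equal; ring].
  + intro H; split; [exact D|]; unfold mdet in D.
    destruct h as [a b c d]; cbn [m11 m12 m21 m22] in *.
    destruct H as [[C A]|[[B E]|[A BC]]].
    * assert (c = 0) by lra; subst c.
      exists Inf; repeat split; [now apply mob_Inf_fixed|cbn].
      eapply Rle_trans; [exact A|right; f_equal; ring].
    * exists (BP e); split; [exact Logic.I|split; [reflexivity|]].
      apply (mob_BP_fixed (mkM2 a b c d)); cbn; split; [lra|].
      eapply Rle_trans; [exact E|right; f_equal; ring].
    * assert (C : c <> 0) by (intros ->; lra).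
      assert (A' : a = d + 2 * c * e) by lra.
      (* The conjugate fixed points have product - b / c and real part e, which leaves this value
         for the square of the height. *)
      assert (Y : 0 < - b / c - e ^ 2).
      { pose proof (pow2_gt_0 c C).
        apply Rmult_lt_reg_l with (c ^ 2); [assumption|].
        replace (c ^ 2 * (- b / c - e ^ 2)) with (- (c * b) - c ^ 2 * e ^ 2) by (field; exact C).
        subst a. nra. }
      exists (HP e (sqrt (- b / c - e ^ 2))).
      assert (P := sqrt_lt_R0 _ Y).
      repeat split; try assumption.
      apply mob_HP_fixed; [exact D|assumption|]; cbn [m11 m12 m21 m22]; split; [lra|].
      rewrite pow2_sqrt by lra; field; exact C.
(* The columns of the frame represent the endpoints m + r and m - r; [w] normalizes the determinant
   to 1. *)
- set (w := / sqrt (2 * r)).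
  assert (Hw : w * w * (2 * r) = 1).
  { unfold w; rewrite <- Rinv_mult, sqrt_sqrt by lra; field; lra. }
  assert (Hr : 0 < w * w) by (unfold w; apply Rmult_lt_0_compat;
    apply Rinv_0_lt_compat, sqrt_lt_R0; lra).
  exists (mkM2 (w * (m + r)) (w * (m - r)) w w); split.
  { unfold mdet; cbn; rewrite <- Hw; ring. }
  intros h D; unfold zero_form, adj, mmul; cbn [m11 m12 m21 m22].
  set (k11 := (w * m11 h + - (w * (m - r)) * m21 h) * (w * (m + r)) +
              (w * m12 h + - (w * (m - r)) * m22 h) * w).
  set (k12 := (w * m11 h + - (w * (m - r)) * m21 h) * (w * (m - r)) +
              (w * m12 h + - (w * (m - r)) * m22 h) * w).
  set (k21 := (- w * m11 h + w * (m + r) * m21 h) * (w * (m + r)) +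
              (- w * m12 h + w * (m + r) * m22 h) * w).
  set (k22 := (- w * m11 h + w * (m + r) * m21 h) * (w * (m - r)) +
              (- w * m12 h + w * (m + r) * m22 h) * w).
  assert (E12 : k12 = w * w * (m11 h * (m - r) + m12 h - (m - r) * (m21 h * (m - r) + m22 h)))
    by (unfold k12; ring).
  assert (E21 : k21 = - (w * w * (m11 h * (m + r) + m12 h - (m + r) * (m21 h * (m + r) + m22 h))))
    by (unfold k21; ring).
  assert (E22 : k22 = - k12 + w * w * (2 * r) * (m21 h * (m - r) + m22 h))
    by (unfold k22, k12; ring).
  assert (E11 : k11 = - k21 + w * w * (2 * r) * (m21 h * (m + r) + m22 h))
    by (unfold k11, k21; ring).
  assert (Ed : k11 - k22 = w * w * ((m11 h - m22 h) * (2 * m) + 2 * m12 h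
                 - 2 * m21 h * ((m - r) * (m + r)))) by (unfold k11, k22; ring).
  rewrite Hw in E11, E22.
  assert (Dk : k11 * k22 - k12 * k21 = 1).
  { transitivity ((w * w * (2 * r)) ^ 2 * mdet h);
      [unfold k11, k12, k21, k22, mdet; ring | rewrite Hw, D; ring]. }
  clearbody k11 k12 k21 k22.
  split.
  + intros (_ & p & Hp & Hl & Hf & Hn).
    destruct p as [x y|x|]; cbn [in_Hbar in_geod_closure] in Hp, Hl; [| |contradiction].
    * destruct Hl as [_ Hl].
      apply mob_HP_fixed in Hf; [|assumption|assumption].
      destruct Hf as [H1 H2].
      assert (K : k11 - k22 = 0).
      { rewrite Ed, H1, H2.
        transitivity (- 2 * w * w * m21 h * ((x - m) ^ 2 + y ^ 2 - r ^ 2)); [ring|].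
        rewrite Hl; ring. }
      destruct (Req_dec (m21 h) 0) as [C|C].
      -- assert (k21 = 0).
         { rewrite E21; rewrite C in *.
           replace (m12 h) with 0 by lra. replace (m11 h) with (m22 h) by lra. ring. }
         left; split; [assumption|]; apply Rabs_ge1. rewrite H in *. nra.
      -- right; right; split; [lra|].
         assert (F1 : k12 = - (w * w * m21 h * ((x - (m - r)) ^ 2 + y ^ 2))).
         { rewrite E12, H2; replace (m11 h) with (m22 h + 2 * m21 h * x) by lra; ring. }
         assert (F2 : k21 = w * w * m21 h * ((x - (m + r)) ^ 2 + y ^ 2)).
         { rewrite E21, H2; replace (m11 h) with (m22 h + 2 * m21 h * x) by lra; ring. }
         rewrite F1, F2.
         assert (Q1 : 0 < (x - (m - r)) ^ 2 + y ^ 2) by (apply Rplus_le_lt_0_compat; [apply pow2_ge_0 | now apply pow2_gt_0, Rgt_not_eq]).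
         assert (Q2 : 0 < (x - (m + r)) ^ 2 + y ^ 2) by (apply Rplus_le_lt_0_compat; [apply pow2_ge_0 | now apply pow2_gt_0, Rgt_not_eq]).
         assert (Q3 : 0 < (w * w * m21 h) ^ 2).
         { apply pow2_gt_0, Rmult_integral_contrapositive_currified; first [assumption | apply Rgt_not_eq; nra]. }
         pose proof (Rmult_lt_0_compat _ _ Q3 (Rmult_lt_0_compat _ _ Q1 Q2)). nra.
    * destruct (proj1 (mob_BP_fixed h x) (conj Hf Hn)) as [H1 _].
      destruct Hl as [-> | ->].
      -- right; left.
         assert (Z : k12 = 0) by (rewrite E12, H1; ring).
         split; [exact Z|]; rewrite E22, Z.
         eapply Rle_trans; [exact Hn|right; f_equal; ring].
      -- left.
         assert (Z : k21 = 0) by (rewrite E21, H1; ring).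
         split; [exact Z|]; rewrite E11, Z.
         eapply Rle_trans; [exact Hn|right; f_equal; ring].
  + intro H; split; [exact D|].
    destruct H as [[C A]|[[B E]|[A BC]]].
    * exists (BP (m + r)); split; [exact Logic.I|split; [right; reflexivity|]].
      apply mob_BP_fixed.
      assert (Z : m11 h * (m + r) + m12 h - (m + r) * (m21 h * (m + r) + m22 h) = 0).
      { apply Rmult_eq_reg_l with (w * w); lra. }
      split; [lra|].
      eapply Rle_trans; [exact A|]; rewrite E11, C; right; f_equal; ring.
    * exists (BP (m - r)); split; [exact Logic.I|split; [left; reflexivity|]].
      apply mob_BP_fixed.
      assert (Z : m11 h * (m - r) + m12 h - (m - r) * (m21 h * (m - r) + m22 h) = 0).
      { apply Rmult_eq_reg_l with (w * w); lra. }
      split; [lra|].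
      eapply Rle_trans; [exact E|]; rewrite E22, B; right; f_equal; ring.
    * assert (Z : (m11 h - m22 h) * m + m12 h - m21 h * ((m - r) * (m + r)) = 0).
      { apply Rmult_eq_reg_l with (w * w * 2); lra. }
      assert (Zb : m12 h = m21 h * ((m - r) * (m + r)) - (m11 h - m22 h) * m) by lra.
      assert (F1 : k12 = w * w * r * (2 * m * m21 h - (m11 h - m22 h) - 2 * r * m21 h))
        by (rewrite E12, Zb; ring).
      assert (F2 : k21 = w * w * r * (2 * m * m21 h - (m11 h - m22 h) + 2 * r * m21 h))
        by (rewrite E21, Zb; ring).
      (* [u] is 2 [m21 h] (m - x), where x is the real part of the fixed point, so k12 k21 < 0 says
         |x - m| < r. *)
      set (u := 2 * m * m21 h - (m11 h - m22 h)) in *.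
      assert (U : u ^ 2 < (2 * r * m21 h) ^ 2).
      { rewrite F1, F2 in BC.
        assert (0 < (w * w * r) ^ 2) by (assert (0 < w * w * r) by nra; nra).
        apply Rmult_lt_reg_l with ((w * w * r) ^ 2); [assumption|nra]. }
      assert (C : m21 h <> 0) by (intro Z0; rewrite Z0 in U; nra).
      set (x := (m11 h - m22 h) / (2 * m21 h)).
      assert (Ex : m11 h - m22 h = 2 * m21 h * x) by (unfold x; field; exact C).
      assert (Y : 0 < r ^ 2 - (x - m) ^ 2).
      { assert (0 < (2 * m21 h) ^ 2) by (apply pow2_gt_0, Rmult_integral_contrapositive_currified; first [assumption | apply Rgt_not_eq; nra]).
        apply Rmult_lt_reg_l with ((2 * m21 h) ^ 2); [assumption|].
        unfold u in U; rewrite Ex in U; nra. }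
      exists (HP x (sqrt (r ^ 2 - (x - m) ^ 2))).
      assert (P := sqrt_lt_R0 _ Y).
      repeat split; try assumption.
      -- rewrite pow2_sqrt by lra; ring.
      -- apply mob_HP_fixed; [exact D|assumption|]; split; [exact Ex|].
         rewrite pow2_sqrt by lra; rewrite Zb, Ex; ring.
Qed.

(** * Sides of a crooked plane *)

(** Openness in SL_2(R) rather than PSL_2(R): paths and limits are taken among matrices, and
    invariance under [mopp] is invoked separately. *)
Definition opn (U : M2 -> Prop) : Prop :=
  forall A, ads_pt A -> U A ->
    exists e, 0 < e /\ forall B, ads_pt B -> mdist A B < e -> U B.

Lemma opn_path (U V : M2 -> Prop) (g : R -> M2) : opn U -> opn V ->
  (forall A, ads_pt A -> U A -> V A -> False) ->
  (forall t, 0 <= t <= 1 -> contP g t /\ ads_pt (g t) /\ (U (g t) \/ V (g t))) ->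
  U (g 0) -> U (g 1).
Proof.
intros HU HV HD Hg H0.
apply (clopen_interval (fun t => U (g t))); [| |exact H0].
- intros t Ht Ut; destruct (Hg t Ht) as (Ct & At & _).
  destruct (HU _ At Ut) as [e [He K]].
  destruct (contP_dist g t e Ct He) as [d [Hd L]].
  exists d; split; [exact Hd|]; intros s Hs Hst.
  apply K; [apply (Hg s Hs) | now apply L].
- intros t Ht Ut; destruct (Hg t Ht) as (Ct & At & [|Vt]); [contradiction|].
  destruct (HV _ At Vt) as [e [He K]].
  destruct (contP_dist g t e Ct He) as [d [Hd L]].
  exists d; split; [exact Hd|]; intros s Hs Hst Us.
  apply (HD (g s)); [apply (Hg s Hs) | exact Us |].
  apply K; [apply (Hg s Hs) | now apply L].
Qed.

Lemma boost_0 (A : M2) : mmul (boost 0) A = A.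
Proof.
unfold boost; replace (1 + 0 ^ 2) with 1 by ring; rewrite sqrt_1.
apply M2_eq; cbn; ring.
Qed.

Lemma ads_boost (s : R) (A : M2) : ads_pt A -> ads_pt (mmul (boost s) A).
Proof. unfold ads_pt; intro H; rewrite mdet_mmul, mdet_boost, H; ring. Qed.

Lemma continuity_boost (f : R -> R) (t : R) : continuity_pt f t ->
  continuity_pt (fun s => sqrt (1 + f s ^ 2)) t.
Proof.
intro Hf.
apply (continuity_pt_comp (fun s => 1 + f s ^ 2) sqrt).
- apply (continuity_pt_comp f (fun x => 1 + x ^ 2)); [exact Hf|].
  apply derivable_continuous_pt; reg.
- apply continuity_pt_sqrt; nra.
Qed.

Lemma contP_boost (c : R) (A : M2) (t : R) : contP (fun s => mmul (boost (c * s)) A) t.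
Proof.
assert (K : continuity_pt (fun s => c * s) t) by (apply derivable_continuous_pt; reg).
assert (Q := continuity_boost _ _ K).
assert (N : forall x, continuity_pt (fun _ : R => x) t)
  by (intro; apply derivable_continuous_pt; reg).
repeat split; unfold boost, mmul; cbn [m11 m12 m21 m22];
  apply continuity_pt_plus; apply continuity_pt_mult; auto.
Qed.

Lemma boost_near (A : M2) (s : R) :
  mdist A (mmul (boost s) A) <= 2 * Rabs s * mnorm A.
Proof.
assert (K : Rabs (sqrt (1 + s ^ 2) - 1) <= Rabs s).
{ assert (1 <= sqrt (1 + s ^ 2)) by (rewrite <- sqrt_1 at 1; apply sqrt_le_1_alt; nra).
  rewrite Rabs_right by lra.
  assert (sqrt (1 + s ^ 2) <= 1 + Rabs s); [|lra].
  pose proof (Rabs_pos s).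
  rewrite <- (sqrt_pow2 (1 + Rabs s)) by lra; apply sqrt_le_1_alt.
  rewrite <- (pow2_abs s); nra. }
assert (E : forall x y, Rabs (x - (sqrt (1 + s ^ 2) * x + s * y)) <= Rabs s * (Rabs x + Rabs y)).
{ intros x y.
  replace (x - (sqrt (1 + s ^ 2) * x + s * y))
    with ((sqrt (1 + s ^ 2) - 1) * (- x) + s * (- y)) by ring.
  eapply Rle_trans; [apply Rabs_triang|].
  rewrite !Rabs_mult, !Rabs_Ropp.
  pose proof (Rabs_pos x); nra. }
pose proof (E (m11 A) (m21 A)); pose proof (E (m12 A) (m22 A)).
pose proof (E (m21 A) (m11 A)); pose proof (E (m22 A) (m12 A)).
unfold mdist, mnorm, boost, mmul; cbn [m11 m12 m21 m22].
rewrite (Rplus_comm (s * m11 A)), (Rplus_comm (s * m12 A)).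
lra.
Qed.

Lemma mnorm_dist (A B : M2) : mnorm B <= mnorm A + mdist A B.
Proof.
assert (K : forall x y, Rabs y <= Rabs x + Rabs (x - y)).
{ intros x y; replace y with (x - (x - y)) at 1 by ring.
  unfold Rminus at 1; eapply Rle_trans; [apply Rabs_triang|].
  rewrite Rabs_Ropp; lra. }
unfold mnorm, mdist.
pose proof (K (m11 A) (m11 B)); pose proof (K (m12 A) (m12 B)).
pose proof (K (m21 A) (m21 B)); pose proof (K (m22 A) (m22 B)); lra.
Qed.

Lemma mnorm_pos (A : M2) : 0 <= mnorm A.
Proof.
unfold mnorm.
pose proof (Rabs_pos (m11 A)); pose proof (Rabs_pos (m12 A)).
pose proof (Rabs_pos (m21 A)); pose proof (Rabs_pos (m22 A)); lra.
Qed.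

Lemma boost_local (h : M2) (e : R) : 0 < e -> exists s d, 0 < s /\ 0 < d /\
  forall B x, mdist h B < d -> Rabs x <= s -> mdist h (mmul (boost x) B) < e.
Proof.
intro He; pose proof (mnorm_pos h).
set (N := mnorm h + 1).
exists (e / (4 * N)), (Rmin 1 (e / 2)).
assert (0 < N) by (unfold N; lra).
repeat split; [apply Rdiv_lt_0_compat; lra | apply Rmin_pos; lra |].
intros B x HB Hx.
pose proof (Rmin_l 1 (e / 2)); pose proof (Rmin_r 1 (e / 2)).
pose proof (mnorm_dist h B); pose proof (boost_near B x).
pose proof (mdist_tri h B (mmul (boost x) B)).
pose proof (Rabs_pos x); pose proof (mnorm_pos B).
assert (Q : Rabs x * mnorm B <= e / (4 * N) * N).
{ apply Rmult_le_compat; try assumption; unfold N; lra. }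
replace (e / (4 * N) * N) with (e / 4) in Q by (field; lra).
lra.
Qed.

(** A boost never returns to the plane from the side it points to: at a zero of [sep] met on the
    way, [boost_sep] for the backward boost would give [sep B] the wrong sign. *)
Lemma boost_sep_persist (B : M2) (eta s : R) : ads_pt B -> eta ^ 2 = 1 -> 0 <= s ->
  0 < eta * sep B -> 0 < eta * sep (mmul (boost (eta * s)) B).
Proof.
intros D He Hs H0.
destruct (Rlt_le_dec 0 (eta * sep (mmul (boost (eta * s)) B))) as [|N]; [assumption|exfalso].
set (f := fun t => eta * sep (mmul (boost (eta * t)) B)).
assert (Cf : continuity f).
{ intro t; apply continuity_pt_mult; [apply derivable_continuous_pt; reg|].
  apply (contP_comp sep (fun t => mmul (boost (eta * t)) B)); [apply cont_sep | apply contP_boost]. }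
assert (f0 : f 0 = eta * sep B) by (unfold f; now rewrite Rmult_0_r, boost_0).
destruct (IVT_cor f 0 s Cf Hs) as [z [Hz Fz]].
{ rewrite f0; fold (f s) in N; nra. }
assert (z <> 0) by (intros ->; lra).
assert (eta <> 0) by (intros ->; lra).
assert (Z : sep (mmul (boost (eta * z)) B) = 0).
{ unfold f in Fz; destruct (Rmult_integral _ _ Fz); [contradiction|assumption]. }
pose proof (boost_sep _ (- (eta * z)) (ads_boost (eta * z) B D) Z) as K.
rewrite boost_opp, mmul_assoc, mmul_adj_l, mmul_1_l in K by apply mdet_boost.
assert (0 < - (eta * z) * sep B); [|nra].
apply K; apply Ropp_neq_0_compat, Rmult_integral_contrapositive_currified; assumption.
Qed.

(** The germ at h of the side [eta] of the crooked plane lies in U. *)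
Definition half_in (U : M2 -> Prop) (eta : R) (h : M2) : Prop :=
  exists e, 0 < e /\ forall B, ads_pt B -> mdist h B < e -> 0 < eta * sep B -> U B.

(** A point B of the side [eta] near h can be boosted until it is close to the boosted h, hence in
    U. On the way it avoids both {sep = 0} and the obstacles [O], so the path runs in the union of
    the disjoint open sets U and V, and B itself is in U. *)
Lemma half_in_of_point (U V O : M2 -> Prop) (h : M2) (eta s d : R) :
  opn U -> opn V -> (forall A, ads_pt A -> U A -> V A -> False) ->
  (forall A, ads_pt A -> sep A <> 0 -> ~ O A -> U A \/ V A) ->
  ads_pt h -> eta ^ 2 = 1 -> 0 < s -> 0 < d ->
  (forall B x, ads_pt B -> mdist h B < d -> Rabs x <= s -> ~ O (mmul (boost x) B)) ->
  U (mmul (boost (eta * s)) h) -> half_in U eta h.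
Proof.
intros HU HV HD Hc Dh He Hs Hd HO Uh.
destruct (HU _ (ads_boost _ _ Dh) Uh) as [e [He0 K]].
destruct (contM_dist (fun B => mmul (boost (eta * s)) B)
  (contM_mmul _ _ (contM_const _) contM_id) h e He0) as [d' [Hd' L]].
exists (Rmin d d'); split; [now apply Rmin_pos|]; intros B DB HB Sg.
pose proof (Rmin_l d d'); pose proof (Rmin_r d d').
assert (UB : U (mmul (boost (eta * s)) B)) by (apply K; [now apply ads_boost | apply L; lra]).
assert (P : U (mmul (boost (eta * s * (1 - 1))) B)).
{ apply (opn_path U V (fun t => mmul (boost (eta * s * (1 - t))) B) HU HV HD).
  - intros t Ht; split; [|split; [now apply ads_boost|]].
    + assert (C := contP_boost (eta * s) B (1 - t)).
      destruct C as (C1 & C2 & C3 & C4).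
      assert (M : continuity_pt (fun t => 1 - t) t) by (apply derivable_continuous_pt; reg).
      repeat split.
      * exact (continuity_pt_comp (fun t => 1 - t) _ t M C1).
      * exact (continuity_pt_comp (fun t => 1 - t) _ t M C2).
      * exact (continuity_pt_comp (fun t => 1 - t) _ t M C3).
      * exact (continuity_pt_comp (fun t => 1 - t) _ t M C4).
    + apply Hc; [now apply ads_boost| |].
      * assert (0 < eta * sep (mmul (boost (eta * (s * (1 - t)))) B)).
        { apply boost_sep_persist; try assumption; nra. }
        rewrite Rmult_assoc; intro Z; rewrite Z in H1; lra.
      * apply HO; [assumption|lra|].
        rewrite !Rabs_mult.
        assert (Rabs eta = 1) by (rewrite <- (pow2_abs eta) in He; pose proof (Rabs_pos eta); nra).
        rewrite H1, (Rabs_right s), (Rabs_right (1 - t)) by lra; nra.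
  - rewrite Rminus_0_r, Rmult_1_r; exact UB. }
rewrite Rminus_diag, Rmult_0_r, boost_0 in P; exact P.
Qed.

Lemma half_in_dichotomy (U V O : M2 -> Prop) (h : M2) (eta : R) :
  opn U -> opn V -> opn (fun A => ~ O A) ->
  (forall A, ads_pt A -> U A -> V A -> False) ->
  (forall A, ads_pt A -> sep A <> 0 -> ~ O A -> U A \/ V A) ->
  ads_pt h -> sep h = 0 -> ~ O h -> eta ^ 2 = 1 ->
  half_in U eta h \/ half_in V eta h.
Proof.
intros HU HV HO HD Hc Dh Z NO He.
destruct (HO h Dh NO) as [e [He0 K]].
destruct (boost_local h e He0) as (s & d & Hs & Hd & L).
assert (A : forall B x, ads_pt B -> mdist h B < d -> Rabs x <= s -> ~ O (mmul (boost x) B)).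
{ intros B x DB HB Hx; apply K; [now apply ads_boost | now apply L]. }
assert (Rabs eta = 1) by (rewrite <- (pow2_abs eta) in He; pose proof (Rabs_pos eta); nra).
assert (eta <> 0) by (intros ->; lra).
assert (N : sep (mmul (boost (eta * s)) h) <> 0).
{ intro E.
  assert (Q : 0 < (eta * s) * sep (mmul (boost (eta * s)) h)).
  { apply boost_sep; [assumption..|].
    apply Rmult_integral_contrapositive_currified; [assumption | now apply Rgt_not_eq]. }
  rewrite E, Rmult_0_r in Q; lra. }
assert (NO' : ~ O (mmul (boost (eta * s)) h)).
{ apply A; [assumption | rewrite mdist_refl; assumption |].
  rewrite Rabs_mult, H, (Rabs_right s); lra. }
destruct (Hc _ (ads_boost _ _ Dh) N NO') as [Uh|Vh]; [left|right].
- now apply (half_in_of_point U V O h eta s d).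
- apply (half_in_of_point V U O h eta s d); try assumption.
  + intros; now apply (HD A0).
  + intros; destruct (Hc A0); tauto.
Qed.

Lemma half_nonempty (h : M2) (eta e : R) : ads_pt h -> sep h = 0 -> eta ^ 2 = 1 -> 0 < e ->
  exists B, ads_pt B /\ mdist h B < e /\ 0 < eta * sep B.
Proof.
intros Dh Z He He0.
destruct (boost_local h e He0) as (s & d & Hs & Hd & L).
assert (eta <> 0) by (intros ->; lra).
exists (mmul (boost (eta * s)) h); split; [now apply ads_boost|split].
- apply L; [rewrite mdist_refl; assumption|].
  assert (Rabs eta = 1) by (rewrite <- (pow2_abs eta) in He; pose proof (Rabs_pos eta); nra).
  rewrite Rabs_mult, H0, (Rabs_right s); lra.
- assert (Q : 0 < (eta * s) * sep (mmul (boost (eta * s)) h)).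
  { apply boost_sep; [assumption..|].
    apply Rmult_integral_contrapositive_currified; [assumption | now apply Rgt_not_eq]. }
  nra.
Qed.

Lemma half_in_stable (U : M2 -> Prop) (eta : R) (h : M2) : half_in U eta h ->
  exists e, 0 < e /\ forall k, mdist h k < e -> half_in U eta k.
Proof.
intros (e & He & K); exists (e / 2); split; [lra|]; intros k Hk.
exists (e / 2); split; [lra|]; intros B DB HB.
apply K; [assumption|]; pose proof (mdist_tri h k B); lra.
Qed.

Lemma half_in_mopp (U : M2 -> Prop) (eta : R) (h : M2) :
  (forall A, ads_pt A -> U A -> U (mopp A)) -> half_in U eta h -> half_in U eta (mopp h).
Proof.
intros HU (e & He & K); exists e; split; [exact He|]; intros B DB HB Sg.
rewrite <- (mopp_mopp B); assert (ads_pt (mopp B)) by (unfold ads_pt; now rewrite mdet_mopp).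
apply HU; [assumption|]; apply K; [assumption| |now rewrite sep_mopp].
rewrite <- mdist_mopp, mopp_mopp; exact HB.
Qed.

(* The zero set of [sep] in PSL_2(R) is connected: every wing and the stem
   retract to the identity. *)
Lemma zero_path (h : M2) : ads_pt h -> sep h = 0 -> exists g : R -> M2,
  g 0 = h /\ (g 1 = mI \/ g 1 = mopp mI) /\
  forall t, 0 <= t <= 1 -> contP g t /\ ads_pt (g t) /\ sep (g t) = 0.
Proof.
assert (W : forall h, ads_pt h -> m21 h = 0 -> 1 <= Rabs (m11 h) -> exists g : R -> M2,
  g 0 = h /\ (g 1 = mI \/ g 1 = mopp mI) /\
  forall t, 0 <= t <= 1 -> contP g t /\ ads_pt (g t) /\ sep (g t) = 0).
{ clear h; intros h D C A; unfold ads_pt, mdet in D; rewrite C in D.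
  assert (A0 : m11 h <> 0) by (intro Z; rewrite Z, Rabs_R0 in A; lra).
  assert (Dh : m22 h = / m11 h) by (apply Rmult_eq_reg_l with (m11 h); [|assumption];
    rewrite Rinv_r by assumption; lra).
  set (e := if Rlt_dec 0 (m11 h) then 1 else -1).
  set (a := fun t => m11 h + (e - m11 h) * t).
  assert (Ha : forall t, 0 <= t <= 1 -> 1 <= e * a t /\ e ^ 2 = 1).
  { intros t Ht; unfold a, e in *; unfold Rabs in A.
    destruct (Rlt_dec 0 (m11 h)), (Rcase_abs (m11 h)); split; nra. }
  exists (fun t => mkM2 (a t) (m12 h * (1 - t)) 0 (/ a t)); split; [|split].
  - apply M2_eq; cbn; unfold a; [ring|ring|now rewrite C|].
    rewrite Rmult_0_r, Rplus_0_r; now rewrite Dh.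
  - assert (a 1 = e) by (unfold a; ring).
    rewrite H; unfold e; destruct (Rlt_dec 0 (m11 h)); [left|right]; apply M2_eq; cbn; field.
  - intros t Ht; destruct (Ha t Ht) as [Ha1 He].
    assert (At : a t <> 0) by (intro Z; rewrite Z in Ha1; lra).
    assert (Dt : ads_pt (mkM2 (a t) (m12 h * (1 - t)) 0 (/ a t))).
    { unfold ads_pt, mdet; cbn; field; exact At. }
    split; [|split; [exact Dt|]].
    + assert (Ca : continuity_pt a t) by (unfold a; apply derivable_continuous_pt; reg).
      repeat split; cbn; [exact Ca| | |].
      * apply derivable_continuous_pt; reg.
      * apply derivable_continuous_pt; reg.
      * now apply (continuity_pt_inv a).
    + apply sep_wing; [exact Dt | reflexivity |]; cbn.
      apply Rabs_ge1; nra. }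
intros D Z; apply (sep_zero h D) in Z; destruct Z as [[C A]|[[B E]|[A BC]]].
- now apply W.
- destruct (W (swap h)) as (g & G0 & G1 & G).
  + unfold ads_pt; now rewrite mdet_swap.
  + exact B.
  + exact E.
  + exists (fun t => swap (g t)); rewrite G0; split; [|split].
    * now destruct h.
    * destruct G1 as [-> | ->]; [left|right]; reflexivity.
    * intros t Ht; destruct (G t Ht) as ((C1 & C2 & C3 & C4) & Dt & Zt).
      unfold ads_pt; rewrite mdet_swap, sep_swap; repeat split; assumption.
- unfold ads_pt, mdet in D.
  set (e := if Rle_dec 0 (m11 h) then 1 else -1).
  assert (He : e * sqrt (1 + m12 h * m21 h) = m11 h).
  { replace (1 + m12 h * m21 h) with (m11 h ^ 2) by (rewrite A in *; lra).
    unfold e; destruct (Rle_dec 0 (m11 h)).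
    - rewrite sqrt_pow2; lra.
    - replace (m11 h ^ 2) with ((- m11 h) ^ 2) by ring; rewrite sqrt_pow2; lra. }
  assert (Ee : e ^ 2 = 1) by (unfold e; destruct (Rle_dec 0 (m11 h)); ring).
  set (b := m12 h) in *; set (c := m21 h) in *.
  set (a := fun t => e * sqrt (1 + (1 - t) ^ 2 * (b * c))).
  exists (fun t => mkM2 (a t) (b * (1 - t)) (c * (1 - t)) (a t)); split; [|split].
  + assert (a 0 = m11 h).
    { unfold a; rewrite <- He; do 2 f_equal; ring. }
    apply M2_eq; cbn; [assumption|unfold b; ring|unfold c; ring|congruence].
  + assert (a 1 = e).
    { unfold a; replace (1 + (1 - 1) ^ 2 * (b * c)) with 1 by ring; rewrite sqrt_1; ring. }
    rewrite H; unfold e; destruct (Rle_dec 0 (m11 h)); [left|right];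
      apply M2_eq; cbn; ring.
  + intros t Ht.
    assert (BC' : -1 <= b * c).
    { rewrite <- A in D; nra. }
    assert (P : 0 <= 1 + (1 - t) ^ 2 * (b * c)).
    { assert (0 <= (1 - t) ^ 2 <= 1) by nra. nra. }
    assert (Sq : a t * a t = 1 + (1 - t) ^ 2 * (b * c)).
    { unfold a; transitivity (e ^ 2 * (sqrt (1 + (1 - t) ^ 2 * (b * c)) *
        sqrt (1 + (1 - t) ^ 2 * (b * c)))); [ring|].
      rewrite sqrt_sqrt by exact P; rewrite Ee; ring. }
    assert (Dt : ads_pt (mkM2 (a t) (b * (1 - t)) (c * (1 - t)) (a t))).
    { unfold ads_pt, mdet; cbn [m11 m12 m21 m22]; rewrite Sq; ring. }
    split; [|split; [exact Dt|]].
    * assert (Ca : continuity_pt a t).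
      { unfold a; apply continuity_pt_mult; [apply derivable_continuous_pt; reg|].
        apply (continuity_pt_comp (fun t => 1 + (1 - t) ^ 2 * (b * c)) sqrt).
        - apply derivable_continuous_pt; reg.
        - now apply continuity_pt_sqrt. }
      repeat split; cbn [m11 m12 m21 m22]; try exact Ca; apply derivable_continuous_pt; reg.
    * destruct (Req_dec t 1) as [->|T].
      -- apply sep_wing; [exact Dt|cbn; ring|]; cbn [m11]; apply Rabs_ge1.
         replace (a 1 ^ 2) with (a 1 * a 1) by ring; rewrite Sq; nra.
      -- apply sep_zero; [exact Dt|]; right; right; cbn [m11 m12 m21 m22]; split; [reflexivity|].
         assert (0 < (1 - t) ^ 2) by (apply pow2_gt_0; lra). nra.
Qed.

(** Along a path in {sep = 0}, the points with [half_in U] and those with [half_in V] form two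
    disjoint open sets covering it. Any two points are joined through the identity; invariance of U
    under [mopp] passes between its two lifts. *)
Lemma half_in_spread (U V O : M2 -> Prop) (eta : R) (h k : M2) :
  opn U -> opn V -> opn (fun A => ~ O A) ->
  (forall A, ads_pt A -> U A -> U (mopp A)) ->
  (forall A, ads_pt A -> U A -> V A -> False) ->
  (forall A, ads_pt A -> sep A <> 0 -> ~ O A -> U A \/ V A) ->
  (forall A, ads_pt A -> sep A = 0 -> ~ O A) -> eta ^ 2 = 1 ->
  ads_pt h -> sep h = 0 -> half_in U eta h ->
  ads_pt k -> sep k = 0 -> half_in U eta k.
Proof.
intros HU HV HO Hm HD Hc Hz He Dh Zh Hh Dk Zk.
assert (S : forall g : R -> M2,
  (forall t, 0 <= t <= 1 -> contP g t /\ ads_pt (g t) /\ sep (g t) = 0) ->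
  (half_in U eta (g 0) -> half_in U eta (g 1)) /\ (half_in U eta (g 1) -> half_in U eta (g 0))).
{ intros g Hg.
  assert (Op : forall t, 0 <= t <= 1 -> half_in U eta (g t) -> exists d, 0 < d /\
    forall s, 0 <= s <= 1 -> Rabs (s - t) < d -> half_in U eta (g s)).
  { intros t Ht H; destruct (half_in_stable _ _ _ H) as [e [He0 K]].
    destruct (contP_dist g t e (proj1 (Hg t Ht)) He0) as [d [Hd L]].
    exists d; split; auto. }
  assert (Cl : forall t, 0 <= t <= 1 -> ~ half_in U eta (g t) -> exists d, 0 < d /\
    forall s, 0 <= s <= 1 -> Rabs (s - t) < d -> ~ half_in U eta (g s)).
  { intros t Ht H; destruct (Hg t Ht) as (Ct & Dt & Zt).
    destruct (half_in_dichotomy U V O (g t) eta) as [|HV']; try tauto; [now apply Hz|].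
    destruct (half_in_stable _ _ _ HV') as [e [He0 K]].
    destruct (contP_dist g t e Ct He0) as [d [Hd L]].
    exists d; split; [exact Hd|]; intros s Hs Hst (e1 & He1 & K1).
    destruct (K (g s) (L s Hst)) as (e2 & He2 & K2).
    destruct (half_nonempty (g s) eta (Rmin e1 e2)) as (B & DB & HB & SB);
      try apply (Hg s Hs); [assumption|now apply Rmin_pos|].
    pose proof (Rmin_l e1 e2); pose proof (Rmin_r e1 e2).
    apply (HD B); [assumption| apply K1 | apply K2]; auto; lra. }
  split.
  - apply (clopen_interval (fun t => half_in U eta (g t))); assumption.
  - intro H1; replace 0 with (1 - 1) by ring.
    apply (clopen_interval (fun t => half_in U eta (g (1 - t)))).
    + intros t Ht H; destruct (Op (1 - t) ltac:(lra) H) as [d [Hd L]].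
      exists d; split; [exact Hd|]; intros s Hs Hst; apply L; [lra|].
      replace (1 - s - (1 - t)) with (- (s - t)) by ring; now rewrite Rabs_Ropp.
    + intros t Ht H; destruct (Cl (1 - t) ltac:(lra) H) as [d [Hd L]].
      exists d; split; [exact Hd|]; intros s Hs Hst; apply L; [lra|].
      replace (1 - s - (1 - t)) with (- (s - t)) by ring; now rewrite Rabs_Ropp.
    + now rewrite Rminus_0_r. }
assert (I1 : half_in U eta mI).
{ destruct (zero_path h Dh Zh) as (g & G0 & G1 & G).
  destruct (S g G) as [S1 _]; rewrite G0 in S1; specialize (S1 Hh).
  destruct G1 as [G1|G1]; rewrite G1 in S1; [assumption|].
  rewrite <- (mopp_mopp mI); now apply half_in_mopp. }
destruct (zero_path k Dk Zk) as (g & G0 & G1 & G).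
destruct (S g G) as [_ S1]; rewrite G0 in S1; apply S1.
destruct G1 as [-> | ->]; [assumption|now apply half_in_mopp].
Qed.

(** * Pinched pairs on the wings *)

Lemma cont_pos (f : M2 -> R) (k : M2) : cont f -> 0 < f k ->
  exists d, 0 < d /\ forall B, mdist k B < d -> 0 < f B.
Proof.
intros Hf Hk; destruct (Hf k (f k) Hk) as [d [Hd K]].
exists d; split; [exact Hd|]; intros B HB.
specialize (K B HB); apply Rabs_def2 in K; lra.
Qed.

(** At a hyperbolic point of the wing the crooked plane is locally the smooth surface m21 = 0: the
    hypotheses of [sep_wing_sign] are open there, and the trace keeps the sign of [m11 k]. *)
Lemma upper_wing_near (k : M2) : ads_pt k -> m21 k = 0 -> 1 < m11 k ^ 2 ->
  exists d, 0 < d /\ forall m eta, ads_pt m -> mdist k m < d ->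
    0 < eta * (m21 m * m11 k) -> 0 < eta * sep m.
Proof.
intros D C A; unfold ads_pt, mdet in D; rewrite C, Rmult_0_r, Rminus_0_r in D.
assert (T : cont (fun m => m11 m + m22 m)) by (apply cont_plus; [apply cont_m11|apply cont_m22]).
assert (Dk : m22 k ^ 2 < 1).
{ assert (m11 k ^ 2 * m22 k ^ 2 = 1) by (transitivity ((m11 k * m22 k) ^ 2); [ring|rewrite D; ring]).
  nra. }
destruct (cont_pos (fun m => m11 m * m11 m - m22 m * m22 m) k) as [d1 [H1 K1]];
  [apply cont_minus; apply cont_mult; first [apply cont_m11 | apply cont_m22] | nra |].
destruct (cont_pos (fun m => (m11 m + m22 m) * (m11 m + m22 m) - 4) k) as [d2 [H2 K2]];
  [apply cont_minus; [now apply cont_mult | apply cont_const] | nra |].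
destruct (cont_pos (fun m => m11 k * (m11 m + m22 m)) k) as [d3 [H3 K3]];
  [now apply cont_scal | nra |].
exists (Rmin d1 (Rmin d2 d3)); split; [repeat apply Rmin_pos; assumption|].
intros m eta Dm Hm Sg.
pose proof (Rmin_l d1 (Rmin d2 d3)); pose proof (Rmin_r d1 (Rmin d2 d3)).
pose proof (Rmin_l d2 d3); pose proof (Rmin_r d2 d3).
specialize (K1 m ltac:(lra)); specialize (K2 m ltac:(lra)); specialize (K3 m ltac:(lra)).
cbv beta in *.
apply sep_wing_sign; [exact Dm | nra | nra |].
apply Rmult_lt_reg_l with (m11 k ^ 2); [lra|].
replace (m11 k ^ 2 * (eta * (m21 m * (m11 m + m22 m))))
  with ((eta * (m21 m * m11 k)) * (m11 k * (m11 m + m22 m))) by ring.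
rewrite Rmult_0_r; now apply Rmult_lt_0_compat.
Qed.

Lemma lower_wing_near (k : M2) : ads_pt k -> m12 k = 0 -> 1 < m22 k ^ 2 ->
  exists d, 0 < d /\ forall m eta, ads_pt m -> mdist k m < d ->
    0 < eta * (m12 m * m22 k) -> 0 < eta * sep m.
Proof.
intros D B E.
destruct (upper_wing_near (swap k)) as [d [Hd K]];
  [unfold ads_pt; now rewrite mdet_swap | exact B | exact E |].
exists d; split; [exact Hd|]; intros m eta Dm Hm Sg.
rewrite <- sep_swap; apply K.
- unfold ads_pt; now rewrite mdet_swap.
- unfold mdist, swap in *; cbn [m11 m12 m21 m22] in *; lra.
- exact Sg.
Qed.

(** [T] stands for g^-1 in coordinates straightening the plane. Both signs [eta] are demanded
    because the side occupied by the region is not known in advance. *)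
Definition pinched (T : M2 -> M2) : Prop :=
  exists k, ads_pt k /\ sep k = 0 /\ sep (T k) = 0 /\
    forall eta e, eta ^ 2 = 1 -> 0 < e -> exists m,
      ads_pt m /\ mdist k m < e /\ 0 < eta * sep m /\ 0 < eta * sep (T m).

(** Along [g] the functions deciding the sides of m and of [T m] are linear with positive slopes, so
    a small parameter of sign [eta] puts both on side [eta]. The image of the base point may lie on
    either wing. *)
Lemma pinched_intro (T : M2 -> M2) (g : R -> M2) (c1 c2 : R) :
  contM T -> (forall A, ads_pt A -> ads_pt (T A)) ->
  contP g 0 -> (forall s, ads_pt (g s)) -> 0 < c1 -> 0 < c2 ->
  m21 (g 0) = 0 -> 1 < m11 (g 0) ^ 2 ->
  (forall s, m21 (g s) * m11 (g 0) = c1 * s) ->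
  (m21 (T (g 0)) = 0 /\ 1 < m11 (T (g 0)) ^ 2 /\
     (forall s, m21 (T (g s)) * m11 (T (g 0)) = c2 * s)) \/
  (m12 (T (g 0)) = 0 /\ 1 < m22 (T (g 0)) ^ 2 /\
     (forall s, m12 (T (g s)) * m22 (T (g 0)) = c2 * s)) ->
  pinched T.
Proof.
intros HT HTd Hg Dg P1 P2 C A L1 H2.
assert (R1 : forall x, 1 < x ^ 2 -> 1 <= Rabs x) by (intros; apply Rabs_ge1; lra).
destruct (upper_wing_near (g 0) (Dg 0) C A) as [d1 [Hd1 K1]].
assert (Z2 : sep (T (g 0)) = 0).
{ destruct H2 as [(C2 & A2 & _)|(B2 & E2 & _)]; [apply sep_wing; auto; now apply HTd|].
  apply sep_zero; [now apply HTd|]; right; left; auto. }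
assert (N2 : exists d, 0 < d /\ forall s eta, mdist (T (g 0)) (T (g s)) < d ->
  0 < eta * (c2 * s) -> 0 < eta * sep (T (g s))).
{ destruct H2 as [(C2 & A2 & L2)|(B2 & E2 & L2)].
  - destruct (upper_wing_near _ (HTd _ (Dg 0)) C2 A2) as [d [Hd K]].
    exists d; split; [exact Hd|]; intros s eta Hs Sg; apply K; [now apply HTd|assumption|].
    now rewrite L2.
  - destruct (lower_wing_near _ (HTd _ (Dg 0)) B2 E2) as [d [Hd K]].
    exists d; split; [exact Hd|]; intros s eta Hs Sg; apply K; [now apply HTd|assumption|].
    now rewrite L2. }
destruct N2 as [d2 [Hd2 K2]].
destruct (contM_dist T HT (g 0) d2 Hd2) as [d3 [Hd3 K3]].
exists (g 0); repeat split; [apply Dg | apply sep_wing; auto; apply Dg | exact Z2 |].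
intros eta e He He0.
destruct (contP_dist g 0 (Rmin e (Rmin d1 d3)) Hg) as [d [Hd K]].
{ repeat apply Rmin_pos; assumption. }
assert (Ra : Rabs eta = 1) by (rewrite <- (pow2_abs eta) in He; pose proof (Rabs_pos eta); nra).
assert (M : mdist (g 0) (g (eta * (d / 2))) < Rmin e (Rmin d1 d3)).
{ apply K; rewrite Rminus_0_r, Rabs_mult, Ra, Rabs_right; lra. }
pose proof (Rmin_l e (Rmin d1 d3)); pose proof (Rmin_r e (Rmin d1 d3)).
pose proof (Rmin_l d1 d3); pose proof (Rmin_r d1 d3).
assert (Q : forall c, 0 < c -> 0 < eta * (c * (eta * (d / 2)))).
{ intros c Hc; replace (eta * (c * (eta * (d / 2)))) with (eta ^ 2 * (c * (d / 2))) by ring.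
  rewrite He, Rmult_1_l; apply Rmult_lt_0_compat; lra. }
exists (g (eta * (d / 2))); repeat split; [apply Dg | lra | |].
- apply K1; [apply Dg | lra | rewrite L1; now apply Q].
- apply K2; [apply K3; lra | now apply Q].
Qed.

(** The two shapes of g^-1 in coordinates: for right planes the coordinates involve inversion, which
    turns left multiplication by u^-1 into right multiplication by u. *)
Definition lmul (u m : M2) : M2 := mmul (adj u) m.
Definition rmul (u m : M2) : M2 := mmul m u.

Lemma lmul_good (u : M2) : ads_pt u -> contM (lmul u) /\ forall A, ads_pt A -> ads_pt (lmul u A).
Proof.
intro D; split; [exact (contM_mmul _ _ (contM_const _) contM_id)|].
unfold ads_pt, lmul in *; intros A HA; rewrite mdet_mmul, mdet_adj, D, HA; ring.
Qed.

Lemma rmul_good (u : M2) : ads_pt u -> contM (rmul u) /\ forall A, ads_pt A -> ads_pt (rmul u A).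
Proof.
intro D; split; [exact (contM_mmul _ _ contM_id (contM_const _))|].
unfold ads_pt, rmul in *; intros A HA; rewrite mdet_mmul, D, HA; ring.
Qed.

Ltac path_continuity :=
  repeat split; cbn [m11 m12 m21 m22 mmul]; apply derivable_continuous_pt; reg.

Lemma pinched_lmul_triangular (u : M2) : ads_pt u -> m21 u = 0 -> pinched (lmul u).
Proof.
intros D C; destruct (lmul_good u D) as [HT HTd].
destruct u as [al be ga de]; unfold ads_pt, mdet in D; cbn [m11 m12 m21 m22] in *; subst ga.
(* Large enough for both a and the corner de a of the image to exceed 1 in modulus, given al de =
   1. *)
set (a := 1 + al ^ 2).
assert (al0 : 0 < al ^ 2) by (apply pow2_gt_0; intro Z; rewrite Z in D; lra).
assert (a0 : 0 < a) by (unfold a; lra).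
assert (AD : al ^ 2 * de ^ 2 = 1).
{ transitivity ((al * de - be * 0) ^ 2); [ring|rewrite D; ring]. }
set (g := fun s => mmul (mkM2 a 0 0 (/ a)) (mkM2 1 s s (1 + s * s))).
apply (pinched_intro _ g 1 1); try assumption; try lra; unfold g, lmul, adj, mmul;
  cbn [m11 m12 m21 m22].
- path_continuity.
- intro s; unfold ads_pt, mdet; cbn [m11 m12 m21 m22]; field; lra.
- ring.
- unfold a; nra.
- intro s; field; lra.
- left; split; [ring|split].
  + replace ((de * (a * 1 + 0 * 0) + - be * (0 * 1 + / a * 0)) ^ 2)
      with (de ^ 2 * a ^ 2) by ring.
    unfold a; nra.
  + intro s. transitivity ((al * de - be * 0) * (/ a * a) * s); [ring|].
    rewrite D; field; lra.
Qed.

Lemma pinched_rmul_triangular (u : M2) : ads_pt u -> m21 u = 0 -> pinched (rmul u).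
Proof.
intros D C; destruct (rmul_good u D) as [HT HTd].
destruct u as [al be ga de]; unfold ads_pt, mdet in D; cbn [m11 m12 m21 m22] in *; subst ga.
set (a := 1 + de ^ 2).
assert (al0 : 0 < al ^ 2) by (apply pow2_gt_0; intro Z; rewrite Z in D; lra).
assert (de0 : 0 < de ^ 2) by (apply pow2_gt_0; intro Z; rewrite Z in D; lra).
assert (a0 : 0 < a) by (unfold a; lra).
assert (AD : al ^ 2 * de ^ 2 = 1).
{ transitivity ((al * de - be * 0) ^ 2); [ring|rewrite D; ring]. }
set (g := fun s => mmul (mkM2 (1 + s * s) s s 1) (mkM2 a 0 0 (/ a))).
assert (a20 : 0 < a ^ 2) by nra.
apply (pinched_intro _ g (a ^ 2) (a ^ 2 * al ^ 2)); try assumption;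
  try (apply Rmult_lt_0_compat; assumption); unfold g, rmul, mmul;
  cbn [m11 m12 m21 m22].
- path_continuity.
- intro s; unfold ads_pt, mdet; cbn [m11 m12 m21 m22]; field; lra.
- ring.
- unfold a; nra.
- intro s; ring.
- left; split; [ring|split].
  + replace ((((1 + 0 * 0) * a + 0 * 0) * al + ((1 + 0 * 0) * 0 + 0 * / a) * 0) ^ 2)
      with (al ^ 2 * a ^ 2) by ring.
    unfold a; nra.
  + intro s; ring.
Qed.

(** The base point, with rows (a, be / (a de)) and (0, 1 / a), is on the wing at oo and is sent to
    the wing at 0, with lower right entry 1 / (a de). Both are hyperbolic exactly when a lies
    between 1 and 1 / |de| in modulus; 2 / (1 + de^2) does, because 2 |de| < 1 + de^2. *)
Lemma pinched_lmul_contract (u : M2) : ads_pt u -> m22 u <> 0 -> m22 u ^ 2 < 1 ->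
  pinched (lmul u).
Proof.
intros D E0 E1; destruct (lmul_good u D) as [HT HTd].
destruct u as [al be ga de]; unfold ads_pt, mdet in D; cbn [m11 m12 m21 m22] in *.
pose proof (pow2_gt_0 _ E0) as E2.
set (a := 2 / (1 + de ^ 2)).
assert (a1 : 1 < a).
{ unfold a; apply Rmult_lt_reg_r with (1 + de ^ 2); [lra|].
  replace (2 / (1 + de ^ 2) * (1 + de ^ 2)) with 2 by (field; lra). lra. }
assert (a2 : a ^ 2 * de ^ 2 < 1).
{ unfold a; apply Rmult_lt_reg_r with ((1 + de ^ 2) ^ 2); [nra|].
  replace ((2 / (1 + de ^ 2)) ^ 2 * de ^ 2 * (1 + de ^ 2) ^ 2) with (4 * de ^ 2)
    by (field; lra).
  assert (0 < (1 - de ^ 2) ^ 2) by (apply pow2_gt_0; lra). nra. }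
set (g := fun s => mmul (mkM2 a (be / (a * de)) 0 (/ a)) (mkM2 1 s s (1 + s * s))).
apply (pinched_intro _ g 1 1); try assumption; try lra; unfold g, lmul, adj, mmul;
  cbn [m11 m12 m21 m22].
- path_continuity.
- intro s; unfold ads_pt, mdet; cbn [m11 m12 m21 m22]; field; lra.
- ring.
- nra.
- intro s; field; lra.
- right.
  assert (W : - ga * (be / (a * de)) + al * / a = / (a * de)).
  { transitivity ((al * de - be * ga) / (a * de)); [field; lra | rewrite D; field; lra]. }
  split; [field; lra|split].
  + replace (- ga * (a * 0 + be / (a * de) * (1 + 0 * 0)) + al * (0 * 0 + / a * (1 + 0 * 0)))
      with (- ga * (be / (a * de)) + al * / a) by ring.
    rewrite W.
    assert (0 < a ^ 2 * de ^ 2) by (apply Rmult_lt_0_compat; nra).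
    replace ((/ (a * de)) ^ 2) with (/ (a ^ 2 * de ^ 2)) by (field; lra).
    rewrite <- Rinv_1; apply Rinv_lt_contravar; lra.
  + intro s.
    replace (- ga * (a * 0 + be / (a * de) * (1 + 0 * 0)) + al * (0 * 0 + / a * (1 + 0 * 0)))
      with (- ga * (be / (a * de)) + al * / a) by ring.
    rewrite W; field; lra.
Qed.

(** Again a point of the wing at oo is sent to the wing at 0. The image has lower right entry de /
    a, so now 1 < a < |de| is wanted, which 2 de^2 / (1 + de^2) satisfies. *)
Lemma pinched_rmul_expand (u : M2) : ads_pt u -> 1 < m22 u ^ 2 -> pinched (rmul u).
Proof.
intros D E1; destruct (rmul_good u D) as [HT HTd].
destruct u as [al be ga de]; unfold ads_pt, mdet in D; cbn [m11 m12 m21 m22] in *.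
assert (E0 : de <> 0) by (intro Z; rewrite Z in E1; lra).
set (a := 2 * de ^ 2 / (1 + de ^ 2)).
assert (a1 : 1 < a).
{ unfold a; apply Rmult_lt_reg_r with (1 + de ^ 2); [lra|].
  replace (2 * de ^ 2 / (1 + de ^ 2) * (1 + de ^ 2)) with (2 * de ^ 2) by (field; lra). lra. }
assert (a2 : a ^ 2 < de ^ 2).
{ unfold a; apply Rmult_lt_reg_r with ((1 + de ^ 2) ^ 2); [nra|].
  replace ((2 * de ^ 2 / (1 + de ^ 2)) ^ 2 * (1 + de ^ 2) ^ 2) with (de ^ 2 * (4 * de ^ 2))
    by (field; lra).
  apply Rmult_lt_compat_l; [lra|].
  assert (0 < (1 - de ^ 2) ^ 2) by (apply pow2_gt_0; lra). nra. }
set (g := fun s => mmul (mkM2 (1 + s * s) s s 1) (mkM2 a (- a * be / de) 0 (/ a))).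
assert (a20 : 0 < a ^ 2) by nra.
assert (c2 : 0 < de ^ 2 / a ^ 2) by (apply Rdiv_lt_0_compat; lra).
apply (pinched_intro _ g (a ^ 2) (de ^ 2 / a ^ 2)); try assumption; unfold g, rmul, mmul;
  cbn [m11 m12 m21 m22].
- path_continuity.
- intro s; unfold ads_pt, mdet; cbn [m11 m12 m21 m22]; field; lra.
- ring.
- nra.
- intro s; ring.
- right; split; [field; lra|split].
  + replace ((0 * a + 1 * 0) * be + (0 * (- a * be / de) + 1 * / a) * de) with (de / a)
      by (field; lra).
    replace ((de / a) ^ 2) with (de ^ 2 / a ^ 2) by (field; lra).
    apply Rmult_lt_reg_r with (a ^ 2); [assumption|].
    replace (de ^ 2 / a ^ 2 * a ^ 2) with (de ^ 2) by (field; lra). lra.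
  + intro s; field; lra.
Qed.

Lemma swap_mmul (A B : M2) : swap (mmul A B) = mmul (swap A) (swap B).
Proof. apply M2_eq; cbn; ring. Qed.

Lemma swap_swap (A : M2) : swap (swap A) = A.
Proof. now destruct A. Qed.

Lemma pinched_swap (T T' : M2 -> M2) :
  (forall m, T' (swap m) = swap (T m)) -> pinched T' -> pinched T.
Proof.
intros E (k & Dk & Z1 & Z2 & H); exists (swap k).
assert (E' : forall m, sep (T (swap m)) = sep (T' m)).
{ intro m; rewrite <- (sep_swap (T _)), <- E, swap_swap; reflexivity. }
split; [unfold ads_pt; now rewrite mdet_swap|].
split; [now rewrite sep_swap|]; split; [now rewrite E'|].
intros eta e He He0; destruct (H eta e He He0) as (m & Dm & Hm & S1 & S2).
exists (swap m); rewrite E', sep_swap; repeat split; try assumption.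
- unfold ads_pt; now rewrite mdet_swap.
- unfold mdist, swap in *; cbn [m11 m12 m21 m22] in *; lra.
Qed.

(* For z <> 0, one of 1 + z and 1 - z lies in (0, 1), which serves left planes, and the
   other one exceeds 1, which serves right planes. *)
Lemma pinched_parabolic (u : M2) (e z : R) : ads_pt u -> e ^ 2 = 1 ->
  m11 u = e * (1 + z) -> m22 u = e * (1 - z) -> Rabs z < 1 ->
  (z = 0 -> m12 u = 0 \/ m21 u = 0) -> pinched (lmul u) /\ pinched (rmul u).
Proof.
intros D He A1 A2 Hz Z.
assert (W : forall u z, ads_pt u -> m11 u = e * (1 + z) -> m22 u = e * (1 - z) ->
  0 < z < 1 -> pinched (lmul u) /\ pinched (rmul (swap u))).
{ clear - He; intros u z D A1 A2 Hz; split.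
  - apply pinched_lmul_contract; [exact D| |].
    + rewrite A2; apply Rmult_integral_contrapositive_currified; [intros ->|]; lra.
    + rewrite A2, Rpow_mult_distr, He; nra.
  - apply pinched_rmul_expand; [unfold ads_pt; now rewrite mdet_swap|].
    cbn [swap m22]; rewrite A1, Rpow_mult_distr, He; nra. }
assert (SL : forall v, pinched (lmul (swap v)) -> pinched (lmul v)).
{ intros v; apply pinched_swap; intro m; unfold lmul; rewrite swap_mmul; reflexivity. }
assert (SR : forall v, pinched (rmul (swap v)) -> pinched (rmul v)).
{ intros v; apply pinched_swap; intro m; unfold rmul; rewrite swap_mmul; reflexivity. }
assert (Ds : ads_pt (swap u)) by (unfold ads_pt; now rewrite mdet_swap).
apply Rabs_def2 in Hz.
destruct (Rtotal_order z 0) as [L|[L|L]].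
- destruct (W (swap u) (- z) Ds) as [P1 P2]; cbn [swap m11 m22]; try lra.
  rewrite swap_swap in P2; auto.
- destruct (Z L) as [B|C].
  + split; [apply SL, pinched_lmul_triangular | apply SR, pinched_rmul_triangular]; auto.
  + split; [apply pinched_lmul_triangular | apply pinched_rmul_triangular]; auto.
- destruct (W u z D A1 A2) as [P1 P2]; [lra | auto].
Qed.

(** * Small values of indefinite binary forms *)

(** (a1, a2) and (b1, b2) will be the columns of a frame of the geodesic; the factors vanish on the
    row vectors annihilating its endpoints. The discriminant is (a1 b2 - a2 b1)^2. *)
Definition form (a1 a2 b1 b2 : R) (p q : Z) : R :=
  (a1 * IZR p + a2 * IZR q) * (b1 * IZR p + b2 * IZR q).

Lemma farey_descent (a1 a2 b1 b2 : R) (n : nat) : forall p1 q1 p2 q2 i j : Z,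
  ((p1 * q2 - p2 * q1) ^ 2 = 1)%Z ->
  0 < form a1 a2 b1 b2 p1 q1 -> 0 < form a1 a2 b1 b2 p2 q2 ->
  (0 <= i)%Z -> (0 <= j)%Z -> (i + j <= Z.of_nat n)%Z ->
  form a1 a2 b1 b2 (i * p1 + j * p2) (i * q1 + j * q2) < 0 ->
  exists p1 q1 p2 q2, ((p1 * q2 - p2 * q1) ^ 2 = 1)%Z /\
    0 < form a1 a2 b1 b2 p1 q1 /\ form a1 a2 b1 b2 p2 q2 <= 0.
Proof.
induction n as [|n IH]; intros p1 q1 p2 q2 i j D Q1 Q2 Hi Hj Hn Q.
- replace i with 0%Z in Q by lia; replace j with 0%Z in Q by lia.
  unfold form in Q; cbn [Z.mul Z.add] in Q; lra.
- destruct (Z.eq_dec i 0) as [->|I0].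
  { exfalso; unfold form in *; rewrite !plus_IZR, !mult_IZR in Q.
    assert (0 <= IZR j ^ 2 * ((a1 * IZR p2 + a2 * IZR q2) * (b1 * IZR p2 + b2 * IZR q2)))
      by (apply Rmult_le_pos; [apply pow2_ge_0|lra]). nra. }
  destruct (Z.eq_dec j 0) as [->|J0].
  { exfalso; unfold form in *; rewrite !plus_IZR, !mult_IZR in Q.
    assert (0 <= IZR i ^ 2 * ((a1 * IZR p1 + a2 * IZR q1) * (b1 * IZR p1 + b2 * IZR q1)))
      by (apply Rmult_le_pos; [apply pow2_ge_0|lra]). nra. }
  destruct (Rlt_le_dec 0 (form a1 a2 b1 b2 (p1 + p2) (q1 + q2))) as [S|S].
  + destruct (Z_le_gt_dec j i).
    * apply (IH p1 q1 (p1 + p2)%Z (q1 + q2)%Z (i - j)%Z j); try assumption; try lia.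
      now replace ((i - j) * p1 + j * (p1 + p2))%Z with (i * p1 + j * p2)%Z by ring;
           replace ((i - j) * q1 + j * (q1 + q2))%Z with (i * q1 + j * q2)%Z by ring.
    * apply (IH (p1 + p2)%Z (q1 + q2)%Z p2 q2 i (j - i)%Z); try assumption; try lia.
      now replace (i * (p1 + p2) + (j - i) * p2)%Z with (i * p1 + j * p2)%Z by ring;
           replace (i * (q1 + q2) + (j - i) * q2)%Z with (i * q1 + j * q2)%Z by ring.
  + exists p1, q1, (p1 + p2)%Z, (q1 + q2)%Z; split; [rewrite <- D; ring|]; split; assumption.
Qed.

(** (x, y) is the real vector at which the two linear factors equal N and - N; rounding it to
    integers changes each factor by less than N and keeps the signs. *)
Lemma form_negative (a1 a2 b1 b2 : R) : (a1 * b2 - a2 * b1) ^ 2 = 1 ->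
  exists p q, form a1 a2 b1 b2 p q < 0.
Proof.
intro D.
set (N := 1 + Rabs a1 + Rabs a2 + Rabs b1 + Rabs b2).
set (d := a1 * b2 - a2 * b1) in *.
set (x := N * d * (b2 + a2)); set (y := - N * d * (b1 + a1)).
assert (E1 : a1 * x + a2 * y = N) by (unfold x, y; transitivity (N * d ^ 2);
  [unfold d; ring | rewrite D; ring]).
assert (E2 : b1 * x + b2 * y = - N) by (unfold x, y; transitivity (- N * d ^ 2);
  [unfold d; ring | rewrite D; ring]).
assert (U : forall r, Rabs (IZR (up r) - r) <= 1).
{ intro r; destruct (archimed r); apply Rabs_le; lra. }
assert (K : forall c e, Rabs (c * IZR (up x) + e * IZR (up y) - (c * x + e * y))
                        <= Rabs c + Rabs e).
{ intros c e.
  replace (c * IZR (up x) + e * IZR (up y) - (c * x + e * y))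
    with (c * (IZR (up x) - x) + e * (IZR (up y) - y)) by ring.
  eapply Rle_trans; [apply Rabs_triang|]; rewrite !Rabs_mult.
  pose proof (Rabs_pos c); pose proof (Rabs_pos e); pose proof (U x); pose proof (U y); nra. }
exists (up x), (up y); unfold form.
pose proof (K a1 a2) as H1; pose proof (K b1 b2) as H2.
rewrite E1 in H1; rewrite E2 in H2.
pose proof (Rabs_pos a1); pose proof (Rabs_pos a2).
pose proof (Rabs_pos b1); pose proof (Rabs_pos b2).
set (L1 := a1 * IZR (up x) + a2 * IZR (up y)) in *.
set (L2 := b1 * IZR (up x) + b2 * IZR (up y)) in *.
assert (V : forall r e, Rabs r <= e -> - e <= r <= e)
  by (intros r e; unfold Rabs; destruct (Rcase_abs r); lra).
apply V in H1, H2; unfold N in *.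
assert (0 < L1) by lra; assert (L2 < 0) by lra; nra.
Qed.

(** In a basis with values A > 0 >= C the discriminant is B^2 - 4 A C = 1. If A >= 1/2 and C <= -
    1/2, this forces B = 0, A = 1/2 and C = - 1/2, and the form vanishes at the sum of the basis
    vectors. *)
Lemma form_small_pos (a1 a2 b1 b2 : R) : (a1 * b2 - a2 * b1) ^ 2 = 1 ->
  0 < form a1 a2 b1 b2 1 0 ->
  exists p q, ~ (p = 0 /\ q = 0)%Z /\ Rabs (form a1 a2 b1 b2 p q) < / 2.
Proof.
intros D Q1.
assert (P : exists p1 q1 p2 q2, ((p1 * q2 - p2 * q1) ^ 2 = 1)%Z /\
    0 < form a1 a2 b1 b2 p1 q1 /\ form a1 a2 b1 b2 p2 q2 <= 0).
{ destruct (form_negative a1 a2 b1 b2 D) as (p & q & H).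
  assert (H' : exists p q, (0 <= p)%Z /\ form a1 a2 b1 b2 p q < 0).
  { destruct (Z_le_gt_dec 0 p); [now exists p, q|].
    exists (- p)%Z, (- q)%Z; split; [lia|]; unfold form in *; rewrite !opp_IZR; nra. }
  clear p q H; destruct H' as (p & q & Hp & H).
  (* In the basis (1, 0), (0, s) the vector (p, q) has the nonnegative coordinates p and |q|. *)
  set (s := if Z_le_gt_dec 0 q then 1%Z else (-1)%Z).
  assert (Hs : (s ^ 2 = 1)%Z /\ (s * Z.abs q = q)%Z)
    by (unfold s; destruct (Z_le_gt_dec 0 q); lia).
  destruct Hs as [Hs1 Hs2].
  destruct (Rlt_le_dec 0 (form a1 a2 b1 b2 0 s)) as [S|S].
  - apply (farey_descent a1 a2 b1 b2 (Z.to_nat (p + Z.abs q)) 1 0 0 s p (Z.abs q));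
      try assumption; try lia.
    replace (p * 1 + Z.abs q * 0)%Z with p by ring.
    replace (p * 0 + Z.abs q * s)%Z with q by lia; exact H.
  - exists 1%Z, 0%Z, 0%Z, s; split; [lia|]; split; assumption. }
destruct P as (p1 & q1 & p2 & q2 & Dt & A & C).
assert (Disc : (form a1 a2 b1 b2 (p1 + p2) (q1 + q2) - form a1 a2 b1 b2 p1 q1
                - form a1 a2 b1 b2 p2 q2) ^ 2
               - 4 * form a1 a2 b1 b2 p1 q1 * form a1 a2 b1 b2 p2 q2 = 1).
{ apply (f_equal IZR) in Dt.
  rewrite Z.pow_2_r, mult_IZR, minus_IZR, !mult_IZR in Dt.
  unfold form; rewrite !plus_IZR.
  transitivity ((a1 * b2 - a2 * b1) ^ 2 *
    ((IZR p1 * IZR q2 - IZR p2 * IZR q1) * (IZR p1 * IZR q2 - IZR p2 * IZR q1))); [ring|].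
  rewrite D, Dt; ring. }
set (QA := form a1 a2 b1 b2 p1 q1) in *; set (QC := form a1 a2 b1 b2 p2 q2) in *.
set (QS := form a1 a2 b1 b2 (p1 + p2) (q1 + q2)) in *.
destruct (Rlt_le_dec QA (/ 2)).
{ exists p1, q1; split; [intros [-> ->]; lia|]; fold QA; rewrite Rabs_right; lra. }
destruct (Rlt_le_dec (- / 2) QC).
{ exists p2, q2; split; [intros [-> ->]; lia|]; fold QC; apply Rabs_def1; lra. }
exists (p1 + p2)%Z, (q1 + q2)%Z; split.
{ intros [E1 E2].
  assert (H : (p1 * q2 - p2 * q1 = 0)%Z).
  { replace p1 with (- p2)%Z by lia; replace q1 with (- q2)%Z by lia; ring. }
  rewrite H in Dt; lia. }
fold QS.
assert (1 <= - 4 * QA * QC) by nra.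
assert (Z : (QS - QA - QC) ^ 2 <= 0) by nra.
assert (Z' : QS = QA + QC) by nra.
assert (QA * - QC = / 4) by nra.
assert (QA = / 2) by nra.
assert (QC = - / 2) by nra.
rewrite Z', H1, H2; rewrite Rabs_right; lra.
Qed.

(* A form of discriminant 1 takes a value below 1/2 in absolute value (the optimal bound
   is 1/sqrt 5). *)
Lemma form_small (a1 a2 b1 b2 : R) : (a1 * b2 - a2 * b1) ^ 2 = 1 ->
  exists p q, ~ (p = 0 /\ q = 0)%Z /\ Rabs (form a1 a2 b1 b2 p q) < / 2.
Proof.
intro D; destruct (Rtotal_order 0 (form a1 a2 b1 b2 1 0)) as [L|[L|L]].
- now apply form_small_pos.
- exists 1%Z, 0%Z; split; [lia|]; rewrite <- L, Rabs_R0; lra.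
- assert (E : forall p q, form a1 a2 (- b1) (- b2) p q = - form a1 a2 b1 b2 p q)
    by (intros; unfold form; ring).
  destruct (form_small_pos a1 a2 (- b1) (- b2)) as (p & q & N & H).
  + rewrite <- D; ring.
  + rewrite E; lra.
  + exists p, q; split; [exact N|]; now rewrite E, Rabs_Ropp in H.
Qed.

(** * The free group Gamma(2) *)

(** Sanov's generators of Gamma(2) modulo sign; [gens] puts them in the second factor, which acts
    from the left. *)
Definition gen_mat (i : nat) : M2 :=
  match i with O => mkM2 1 2 0 1 | _ => mkM2 1 0 2 1 end.

Definition gens (i : nat) : M2 * M2 := (mI, gen_mat i).

Definition letter_mat (l : letter) : M2 :=
  if snd l then adj (gen_mat (fst l)) else gen_mat (fst l).

Definition word_mat (w : list letter) : M2 :=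
  fold_right (fun l M => mmul (letter_mat l) M) mI w.

Lemma mdet_gen_mat (i : nat) : mdet (gen_mat i) = 1.
Proof. destruct i; unfold mdet; cbn; ring. Qed.

Lemma mdet_letter_mat (l : letter) : mdet (letter_mat l) = 1.
Proof. unfold letter_mat; destruct (snd l); rewrite ?mdet_adj; apply mdet_gen_mat. Qed.

Lemma mdet_word_mat (w : list letter) : mdet (word_mat w) = 1.
Proof.
induction w as [|l w IH]; cbn [word_mat fold_right]; [unfold mdet; cbn; ring|].
fold (word_mat w); rewrite mdet_mmul, IH, mdet_letter_mat; ring.
Qed.

Lemma act_word_mat (w : list letter) (A : M2) : act_word gens w A = mmul (word_mat w) A.
Proof.
induction w as [|l w IH]; cbn [act_word word_mat fold_right]; [now rewrite mmul_1_l|].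
fold (act_word gens w A) (word_mat w); rewrite IH, <- mmul_assoc.
unfold act_letter, letter_mat, act_pair, act_pair_inv, gens; destruct (snd l); cbn [fst snd].
- now rewrite mmul_1_r, minv_adj by apply mdet_gen_mat.
- rewrite (minv_adj mI) by (unfold mdet; cbn; ring).
  replace (adj mI) with mI by (apply M2_eq; cbn; ring); now rewrite mmul_1_r.
Qed.

(** Reduced words are kept because disjointness of translates is formulated for them; a matrix other
    than [mI] then comes from a nonempty one. *)
Definition in_group (M : M2) : Prop := exists w, reduced 2 w /\ M = word_mat w.

Lemma in_group_letter (l : letter) (M : M2) : (fst l < 2)%nat ->
  in_group M -> in_group (mmul (letter_mat l) M).
Proof.
intros Hl (w & [F N] & ->).
assert (Cons : (forall l2 t, w = l2 :: t -> ~ (fst l = fst l2 /\ snd l <> snd l2)) ->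
  in_group (mmul (letter_mat l) (word_mat w))).
{ intro H; exists (l :: w); split; [|reflexivity]; split; [now constructor|].
  destruct w as [|l2 t]; [exact Logic.I|]; split; [now apply (H l2 t)|exact N]. }
destruct w as [|l2 t]; [apply Cons; discriminate|].
destruct (classic (fst l = fst l2 /\ snd l <> snd l2)) as [[E1 E2]|NE].
- exists t; split.
  + split; [now inversion F|]; destruct t; [exact Logic.I|apply N].
  + cbn [word_mat fold_right]; rewrite mmul_assoc.
    replace (mmul (letter_mat l) (letter_mat l2)) with mI; [now rewrite mmul_1_l|].
    destruct l as [i b], l2 as [i2 b2]; cbn [fst snd] in *; subst i2.
    unfold letter_mat; cbn [fst snd].
    destruct b, b2; try (now elim E2); symmetry;
      [apply mmul_adj_l | apply mmul_adj_r]; apply mdet_gen_mat.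
- apply Cons; intros l' t' E; injection E as <- <-; exact NE.
Qed.

Lemma in_group_1 : in_group mI.
Proof. exists nil; split; [split; [constructor|exact Logic.I]|reflexivity]. Qed.

Lemma in_group_gen (l : letter) : (fst l < 2)%nat -> in_group (letter_mat l).
Proof. intro H; rewrite <- (mmul_1_r (letter_mat l)); now apply in_group_letter, in_group_1. Qed.

Lemma in_group_mul (M N : M2) : in_group M -> in_group N -> in_group (mmul M N).
Proof.
intros (w & [F _] & ->) HN; induction w as [|l w IH]; cbn [word_mat fold_right].
- now rewrite mmul_1_l.
- inversion F; subst; rewrite <- mmul_assoc; apply in_group_letter; auto.
Qed.

Lemma in_group_conj (l : letter) (M : M2) : (fst l < 2)%nat -> in_group M ->
  in_group (mmul (mmul (letter_mat l) M) (letter_mat (fst l, negb (snd l)))).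
Proof.
intros Hl HM; apply in_group_mul; [now apply in_group_letter | now apply in_group_gen].
Qed.

(* e (1 + 2 k N), where N is the product of the column (q, -p) and the row (p, q);
   conjugation transforms (p, q) as a row vector. *)
Definition parabolic (e k : R) (p q : Z) : M2 :=
  mkM2 (e * (1 + 2 * k * (IZR p * IZR q))) (e * (2 * k * IZR q ^ 2))
       (e * (- (2 * k * IZR p ^ 2))) (e * (1 - 2 * k * (IZR p * IZR q))).

(** Euclid's algorithm with even steps: conjugation by a letter changes one entry of (p, q) by twice
    the other, lowering |p| + |q| until an entry vanishes or p = q or p = - q. The matrix is then a
    letter or minus a parabolic product of two letters, whence e = -1; k is the inverse square of
    the common factor. *)
Lemma parabolic_in_group (n : nat) : forall p q : Z,
  ~ (p = 0 /\ q = 0)%Z -> (Z.abs p + Z.abs q <= Z.of_nat n)%Z ->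
  exists e k, e ^ 2 = 1 /\ 0 < k <= 1 /\ in_group (parabolic e k p q).
Proof.
assert (Inv : forall r : Z, r <> 0%Z -> 0 < / IZR r ^ 2 <= 1 /\ IZR r <> 0).
{ intros r Hr; assert (N : IZR r <> 0) by (now apply not_0_IZR).
  split; [|exact N]; split; [now apply Rinv_0_lt_compat, pow2_gt_0|].
  rewrite <- Rinv_1; apply Rinv_le_contravar; [lra|].
  rewrite pow_IZR; apply IZR_le; cbn [Z.of_nat Pos.of_succ_nat Pos.succ].
  rewrite Z.pow_2_r; nia. }
induction n as [|n IH]; intros p q Hpq Hn; [exfalso; lia|].
destruct (Z.eq_dec p 0) as [->|P0].
{ assert (Q0 : q <> 0%Z) by lia; destruct (Inv q Q0) as [K N].
  exists 1, (/ IZR q ^ 2); split; [ring|split; [exact K|]].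
  replace (parabolic _ _ _ _) with (letter_mat (0%nat, false)); [apply in_group_gen; cbn; lia|].
  apply M2_eq; cbn [letter_mat fst snd gen_mat parabolic m11 m12 m21 m22]; field; exact N. }
destruct (Z.eq_dec q 0) as [->|Q0].
{ destruct (Inv p P0) as [K N].
  exists 1, (/ IZR p ^ 2); split; [ring|split; [exact K|]].
  replace (parabolic _ _ _ _) with (letter_mat (1%nat, true)); [apply in_group_gen; cbn; lia|].
  apply M2_eq; cbn [letter_mat fst snd gen_mat parabolic adj m11 m12 m21 m22]; field; exact N. }
destruct (Z.eq_dec p q) as [E|NE].
{ subst q; destruct (Inv p P0) as [K N].
  exists (-1), (/ IZR p ^ 2); split; [ring|split; [exact K|]].
  replace (parabolic _ _ _ _)
    with (mmul (letter_mat (0%nat, true)) (letter_mat (1%nat, false))).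
  - apply in_group_mul; apply in_group_gen; cbn; lia.
  - apply M2_eq; cbn [letter_mat fst snd gen_mat parabolic adj mmul m11 m12 m21 m22];
      field; exact N. }
destruct (Z.eq_dec p (- q)) as [E|NE'].
{ subst p; destruct (Inv q Q0) as [K N].
  exists (-1), (/ IZR q ^ 2); split; [ring|split; [exact K|]].
  replace (parabolic _ _ _ _)
    with (mmul (letter_mat (1%nat, false)) (letter_mat (0%nat, true))).
  - apply in_group_mul; apply in_group_gen; cbn; lia.
  - apply M2_eq; cbn [letter_mat fst snd gen_mat parabolic adj mmul m11 m12 m21 m22];
      rewrite ?opp_IZR; field; exact N. }
assert (Step : forall l p' q', (fst l < 2)%nat -> ~ (p' = 0 /\ q' = 0)%Z ->
  (Z.abs p' + Z.abs q' <= Z.of_nat n)%Z ->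
  (forall e k, parabolic e k p q =
     mmul (mmul (letter_mat l) (parabolic e k p' q')) (letter_mat (fst l, negb (snd l)))) ->
  exists e k, e ^ 2 = 1 /\ 0 < k <= 1 /\ in_group (parabolic e k p q)).
{ intros l p' q' Hl N H E; destruct (IH p' q' N H) as (e & k & He & Hk & G).
  exists e, k; split; [exact He|split; [exact Hk|]].
  rewrite E; now apply in_group_conj. }
destruct (Z_lt_ge_dec (Z.abs q) (Z.abs p)) as [L|L];
  (destruct (Z_lt_ge_dec 0 (p * q)) as [S|S]).
- apply (Step (1%nat, true) (p - 2 * q)%Z q); [cbn; lia|lia|nia|].
  intros e k; apply M2_eq; cbn [letter_mat fst snd negb gen_mat parabolic adj mmul m11 m12 m21 m22];
    rewrite minus_IZR, mult_IZR; ring.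
- apply (Step (1%nat, false) (p + 2 * q)%Z q); [cbn; lia|lia|nia|].
  intros e k; apply M2_eq; cbn [letter_mat fst snd negb gen_mat parabolic adj mmul m11 m12 m21 m22];
    rewrite plus_IZR, mult_IZR; ring.
- apply (Step (0%nat, true) p (q - 2 * p)%Z); [cbn; lia|lia|nia|].
  intros e k; apply M2_eq; cbn [letter_mat fst snd negb gen_mat parabolic adj mmul m11 m12 m21 m22];
    rewrite minus_IZR, mult_IZR; ring.
- apply (Step (0%nat, false) p (q + 2 * p)%Z); [cbn; lia|lia|nia|].
  intros e k; apply M2_eq; cbn [letter_mat fst snd negb gen_mat parabolic adj mmul m11 m12 m21 m22];
    rewrite plus_IZR, mult_IZR; ring.
Qed.

Lemma parabolic_neq_1 (e k : R) (p q : Z) : e ^ 2 = 1 -> 0 < k -> ~ (p = 0 /\ q = 0)%Z ->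
  parabolic e k p q <> mI.
Proof.
intros He Hk N E.
assert (e0 : e <> 0) by (intro Z; rewrite Z in He; lra).
assert (P : forall r : Z, e * (2 * k * IZR r ^ 2) = 0 -> r = 0%Z).
{ intros r H; apply eq_IZR; destruct (Req_dec (IZR r) 0) as [|R0]; [assumption|exfalso].
  revert H; apply Rmult_integral_contrapositive_currified; [exact e0|].
  pose proof (pow2_gt_0 _ R0); apply Rgt_not_eq; nra. }
apply N; split; apply P.
- apply (f_equal m21) in E; cbn [parabolic mI m21] in E; lra.
- apply (f_equal m12) in E; exact E.
Qed.

(* Ping-pong: once both coordinates are nonzero, every further letter of a reduced
   word increases the l^1 norm of an integer vector by at least 1. *)
Definition aimed (l : letter) (x y : R) : Prop :=
  let s := if snd l then -1 else 1 in
  match fst l with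
  | O => 1 <= Rabs y /\ Rabs y + 1 <= Rabs x /\ 0 <= s * (x * y)
  | _ => 1 <= Rabs x /\ Rabs x + 1 <= Rabs y /\ 0 <= s * (x * y)
  end.

Definition img1 (M : M2) (x y : R) : R := m11 M * x + m12 M * y.
Definition img2 (M : M2) (x y : R) : R := m21 M * x + m22 M * y.

Lemma aimed_step (l l' : letter) (x y : R) :
  ~ (fst l' = fst l /\ snd l' <> snd l) -> (fst l < 2)%nat -> (fst l' < 2)%nat ->
  aimed l x y ->
  aimed l' (img1 (letter_mat l') x y) (img2 (letter_mat l') x y) /\
  Rabs x + Rabs y + 1 <=
    Rabs (img1 (letter_mat l') x y) + Rabs (img2 (letter_mat l') x y).
Proof.
intros N H H' A; destruct l as [i b], l' as [i' b']; cbn [fst snd] in *.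
unfold aimed, img1, img2, letter_mat in *; cbn [fst snd] in *.
(* One computation for both generators, up to exchanging x and y; s and t are the signs of the
   previous and of the new letter. The other generator adds twice the dominant coordinate to the
   smaller one; a repeated letter adds twice the smaller one with the sign that increases the
   dominant one. *)
assert (C : forall s t x y : R, (s = 1 \/ s = -1) -> (t = 1 \/ t = -1) ->
  1 <= Rabs y -> Rabs y + 1 <= Rabs x -> 0 <= s * (x * y) ->
  (1 <= Rabs x /\ Rabs x + 1 <= Rabs (t * 2 * x + y) /\ 0 <= t * (x * (t * 2 * x + y)) /\
   Rabs x + Rabs y + 1 <= Rabs x + Rabs (t * 2 * x + y)) /\
  (s = t -> Rabs y + 1 <= Rabs (x + t * 2 * y) /\ 0 <= t * ((x + t * 2 * y) * y) /\
   Rabs x + Rabs y + 1 <= Rabs (x + t * 2 * y) + Rabs y)).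
{ clear; intros s t x y Hs Ht H1 H2 H3; split.
  - assert (T : 0 <= t * (x * (t * 2 * x + y))).
    { assert (t ^ 2 = 1) by (destruct Ht; subst; ring).
      assert (Rabs x * Rabs x = x ^ 2) by (rewrite <- Rabs_mult, Rabs_right; nra).
      assert (- (Rabs x * Rabs y) <= t * (x * y)).
      { rewrite <- Rabs_mult; unfold Rabs; destruct (Rcase_abs (x * y)), Ht; subst; nra. }
      nra. }
    split; [lra|split; [|split; [exact T|]]]; clear T; clear H3 Hs;
    unfold Rabs in *;
    destruct Ht; subst; destruct (Rcase_abs x), (Rcase_abs y), (Rcase_abs (_ + y)); lra.
  - intros <-.
    assert (K : Rabs (x + s * 2 * y) = Rabs x + 2 * Rabs y).
    { unfold Rabs in *;
      destruct Hs; subst; destruct (Rcase_abs x), (Rcase_abs y), (Rcase_abs (x + _)); nra. }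
    rewrite K; split; [lra|split; [|lra]].
    assert (s ^ 2 = 1) by (destruct Hs; subst; ring). nra. }
assert (B : forall b : bool, (if b then -1 else 1) = 1 \/ (if b then -1 else 1) = -1)
  by (intros []; auto).
destruct i as [|[|]], i' as [|[|]]; try lia; destruct A as (A1 & A2 & A3).
- assert (b = b') by (destruct b, b'; tauto || (exfalso; apply N; split; [reflexivity|discriminate])).
  subst b'; destruct (C _ _ x y (B b) (B b) A1 A2 A3) as [_ K].
  destruct (K eq_refl) as (K1 & K2 & K3).
  destruct b; cbn [gen_mat adj m11 m12 m21 m22] in *.
  + replace (1 * x + - (2) * y) with (x + -1 * 2 * y) by ring.
    replace (- 0 * x + 1 * y) with y by ring. tauto.
  + replace (1 * x + 2 * y) with (x + 1 * 2 * y) by ring.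
    replace (0 * x + 1 * y) with y by ring. tauto.
- destruct (C _ _ x y (B b) (B b') A1 A2 A3) as [(K1 & K2 & K3 & K4) _].
  destruct b'; cbn [gen_mat adj m11 m12 m21 m22] in *.
  + replace (1 * x + - 0 * y) with x by ring.
    replace (- (2) * x + 1 * y) with (-1 * 2 * x + y) by ring. tauto.
  + replace (1 * x + 0 * y) with x by ring.
    replace (2 * x + 1 * y) with (1 * 2 * x + y) by ring. tauto.
- rewrite (Rmult_comm x y) in A3.
  destruct (C _ _ y x (B b) (B b') A1 A2 A3) as [(K1 & K2 & K3 & K4) _].
  destruct b'; cbn [gen_mat adj m11 m12 m21 m22] in *.
  + replace (1 * x + - (2) * y) with (-1 * 2 * y + x) by ring.
    replace (- 0 * x + 1 * y) with y by ring.
    rewrite (Rmult_comm (-1 * 2 * y + x)), (Rplus_comm (Rabs (-1 * 2 * y + x))), (Rplus_comm (Rabs x) (Rabs y)). tauto.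
  + replace (1 * x + 2 * y) with (1 * 2 * y + x) by ring.
    replace (0 * x + 1 * y) with y by ring.
    rewrite (Rmult_comm (1 * 2 * y + x)), (Rplus_comm (Rabs (1 * 2 * y + x))), (Rplus_comm (Rabs x) (Rabs y)). tauto.
- assert (b = b') by (destruct b, b'; tauto || (exfalso; apply N; split; [reflexivity|discriminate])).
  subst b'; rewrite (Rmult_comm x y) in A3.
  destruct (C _ _ y x (B b) (B b) A1 A2 A3) as [_ K].
  destruct (K eq_refl) as (K1 & K2 & K3).
  destruct b; cbn [gen_mat adj m11 m12 m21 m22] in *.
  + replace (1 * x + - 0 * y) with x by ring.
    replace (- (2) * x + 1 * y) with (y + -1 * 2 * x) by ring.
    rewrite (Rmult_comm x (y + -1 * 2 * x)), (Rplus_comm (Rabs x) (Rabs (y + -1 * 2 * x))), (Rplus_comm (Rabs x) (Rabs y)). tauto.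
  + replace (1 * x + 0 * y) with x by ring.
    replace (2 * x + 1 * y) with (y + 1 * 2 * x) by ring.
    rewrite (Rmult_comm x (y + 1 * 2 * x)), (Rplus_comm (Rabs x) (Rabs (y + 1 * 2 * x))), (Rplus_comm (Rabs x) (Rabs y)). tauto.
Qed.

Lemma img_mmul (A B : M2) (x y : R) :
  img1 (mmul A B) x y = img1 A (img1 B x y) (img2 B x y) /\
  img2 (mmul A B) x y = img2 A (img1 B x y) (img2 B x y).
Proof. unfold img1, img2; cbn; split; ring. Qed.

Lemma word_growth (l : letter) (w : list letter) : reduced 2 (l :: w) ->
  exists x y, Rabs x <= 1 /\ Rabs y <= 1 /\
    let X := img1 (word_mat (l :: w)) x y in let Y := img2 (word_mat (l :: w)) x y in
    aimed l X Y /\ INR (length (l :: w)) <= Rabs X + Rabs Y.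
Proof.
revert l; induction w as [|l2 w IH]; intros l [F N].
- assert (R3 : Rabs 3 = 3) by (apply Rabs_right; lra).
  assert (Rm3 : Rabs (-3) = 3) by (rewrite Rabs_left; lra).
  assert (Rm1 : Rabs (-1) = 1) by (rewrite Rabs_left; lra).
  inversion F as [|? ? Hl _]; subst; destruct l as [[|[|i]] b]; cbn [fst] in Hl; [| |lia].
  (* The start vector is fitted to the rightmost letter, which sends it to (3, 1) or (-3, 1). *)
  + exists (if b then -1 else 1), 1.
    unfold img1, img2, word_mat, letter_mat, aimed; destruct b; cbn -[Rabs INR];
      [replace ((1 * 1 + - (2) * 0) * -1 + (1 * 0 + - (2) * 1) * 1) with (-3) by ring;
       replace ((- 0 * 1 + 1 * 0) * -1 + (- 0 * 0 + 1 * 1) * 1) with 1 by ring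
      |replace ((1 * 1 + 2 * 0) * 1 + (1 * 0 + 2 * 1) * 1) with 3 by ring;
       replace ((0 * 1 + 1 * 0) * 1 + (0 * 0 + 1 * 1) * 1) with 1 by ring];
      rewrite ?R3, ?Rm3, ?Rm1, ?Rabs_R1; cbn [INR length]; repeat split; lra.
  + exists 1, (if b then -1 else 1).
    unfold img1, img2, word_mat, letter_mat, aimed; destruct b; cbn -[Rabs INR];
      [replace ((1 * 1 + - 0 * 0) * 1 + (1 * 0 + - 0 * 1) * -1) with 1 by ring;
       replace ((- (2) * 1 + 1 * 0) * 1 + (- (2) * 0 + 1 * 1) * -1) with (-3) by ring
      |replace ((1 * 1 + 0 * 0) * 1 + (1 * 0 + 0 * 1) * 1) with 1 by ring;
       replace ((2 * 1 + 1 * 0) * 1 + (2 * 0 + 1 * 1) * 1) with 3 by ring];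
      rewrite ?R3, ?Rm3, ?Rm1, ?Rabs_R1; cbn [INR length]; repeat split; lra.
- destruct N as [N1 N2]; inversion F as [|? ? Hl F']; subst.
  destruct (IH l2 (conj F' N2)) as (x & y & Hx & Hy & A & L).
  exists x, y; split; [exact Hx|split; [exact Hy|]].
  inversion F'; subst.
  destruct (aimed_step l2 l _ _ N1 ltac:(assumption) Hl A) as [A' G].
  change (word_mat (l :: l2 :: w)) with (mmul (letter_mat l) (word_mat (l2 :: w))).
  destruct (img_mmul (letter_mat l) (word_mat (l2 :: w)) x y) as [-> ->].
  split; [exact A'|].
  replace (INR (length (l :: l2 :: w))) with (INR (length (l2 :: w)) + 1).
  + lra.
  + change (length (l :: l2 :: w)) with (S (length (l2 :: w))); now rewrite S_INR.
Qed.

Lemma word_length_norm (w : list letter) : reduced 2 w -> INR (length w) <= mnorm (word_mat w).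
Proof.
destruct w as [|l w]; intro H; [apply mnorm_pos|].
destruct (word_growth l w H) as (x & y & Hx & Hy & _ & L).
eapply Rle_trans; [exact L|].
assert (K : forall a b, Rabs (a * x + b * y) <= Rabs a + Rabs b).
{ intros a b; eapply Rle_trans; [apply Rabs_triang|]; rewrite !Rabs_mult.
  pose proof (Rabs_pos a); pose proof (Rabs_pos b); nra. }
unfold img1, img2, mnorm.
pose proof (K (m11 (word_mat (l :: w))) (m12 (word_mat (l :: w)))).
pose proof (K (m21 (word_mat (l :: w))) (m22 (word_mat (l :: w)))).
lra.
Qed.

(** * Proper discontinuity *)

Lemma mnorm_mmul (A B : M2) : mnorm (mmul A B) <= mnorm A * mnorm B.
Proof.
assert (K : forall a b c d, Rabs (a * b + c * d) <= Rabs a * Rabs b + Rabs c * Rabs d).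
{ intros; eapply Rle_trans; [apply Rabs_triang|]; rewrite !Rabs_mult; lra. }
unfold mnorm, mmul; cbn [m11 m12 m21 m22].
pose proof (K (m11 A) (m11 B) (m12 A) (m21 B)); pose proof (K (m11 A) (m12 B) (m12 A) (m22 B)).
pose proof (K (m21 A) (m11 B) (m22 A) (m21 B)); pose proof (K (m21 A) (m12 B) (m22 A) (m22 B)).
pose proof (Rabs_pos (m11 A)); pose proof (Rabs_pos (m12 A)).
pose proof (Rabs_pos (m21 A)); pose proof (Rabs_pos (m22 A)).
pose proof (Rabs_pos (m11 B)); pose proof (Rabs_pos (m12 B)).
pose proof (Rabs_pos (m21 B)); pose proof (Rabs_pos (m22 B)).
nra.
Qed.

Lemma mnorm_adj (A : M2) : mnorm (adj A) = mnorm A.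
Proof. unfold mnorm, adj; cbn [m11 m12 m21 m22]; rewrite !Rabs_Ropp; ring. Qed.

Lemma words_finite (n : nat) : exists L : list (list letter),
  forall w, reduced 2 w -> (length w <= n)%nat -> In w L.
Proof.
assert (P : exists L : list (list letter), forall w, Forall (fun l => (fst l < 2)%nat) w ->
  (length w <= n)%nat -> In w L).
{ induction n as [|n [L IH]].
  - exists [[]]; intros [|l w] _ H; [now left|cbn in H; lia].
  - exists ([] :: flat_map (fun w => map (fun l => l :: w)
      [(0, true); (0, false); (1, true); (1, false)]%nat) L).
    intros [|l w] F H; [now left|right].
    inversion F as [|? ? Hl F']; subst; cbn [length] in H.
    apply in_flat_map; exists w; split; [apply IH; [exact F'|lia]|].
    apply in_map_iff; exists l; split; [reflexivity|].
    destruct l as [[|[|i]] []]; cbn [fst] in Hl; cbn; auto; lia. }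
destruct P as [L HL]; exists L; intros w [F _]; now apply HL.
Qed.

(** If A and w A both lie in K, then w = (w A) A^-1 has norm at most M^2, and the norm bounds the
    word length. *)
Lemma gens_properly_discontinuous : properly_discontinuous 2 gens.
Proof.
intros K (_ & _ & M & HM).
destruct (INR_unbounded (M * M)) as [n Hn].
destruct (words_finite n) as [L HL].
exists L; intros w Hw (A & DA & KA & KB).
apply HL; [exact Hw|]; apply INR_le.
rewrite act_word_mat in KB.
assert (DB : ads_pt (mmul (word_mat w) A)).
{ unfold ads_pt in *; rewrite mdet_mmul, mdet_word_mat, DA; ring. }
pose proof (HM A DA KA) as H1; pose proof (HM _ DB KB) as H2.
pose proof (word_length_norm w Hw) as H3.
assert (E : word_mat w = mmul (mmul (word_mat w) A) (adj A)).
{ now rewrite <- mmul_assoc, mmul_adj_r, mmul_1_r by exact DA. }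
rewrite E in H3.
pose proof (mnorm_mmul (mmul (word_mat w) A) (adj A)) as H4; rewrite mnorm_adj in H4.
pose proof (mnorm_pos A); pose proof (mnorm_pos (mmul (word_mat w) A)).
nra.
Qed.

(** * Crooked planes meet a cubic curve in finitely many points *)

Definition finite_pred {T : Type} (Q : T -> Prop) : Prop :=
  exists L : list T, forall t, Q t -> In t L.

Lemma finite_union {T U : Type} (L : list T) (Q : T -> U -> Prop) :
  (forall x, In x L -> finite_pred (Q x)) -> finite_pred (fun t => exists x, In x L /\ Q x t).
Proof.
induction L as [|x L IH]; intro H.
- exists []; intros t (? & [] & _).
- destruct (H x (or_introl eq_refl)) as [L1 H1].
  destruct IH as [L2 H2]; [intros y Hy; apply H; now right|].
  exists (L1 ++ L2); intros t (y & [<-|Hy] & Q'); apply in_or_app; [left; auto|right].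
  apply H2; now exists y.
Qed.

Lemma finite_pred_or {T : Type} (Q Q' : T -> Prop) :
  finite_pred Q -> finite_pred Q' -> finite_pred (fun t => Q t \/ Q' t).
Proof.
intros [L H] [L' H']; exists (L ++ L'); intros t [|]; apply in_or_app; auto.
Qed.

Lemma finite_avoid_interval (Q : R -> Prop) (a b : R) : finite_pred Q -> a < b ->
  exists c d, a <= c /\ c < d /\ d <= b /\ forall t, c <= t <= d -> ~ Q t.
Proof.
intros [L HL] Hab.
assert (K : exists c d, a <= c /\ c < d /\ d <= b /\ forall t, c <= t <= d -> ~ In t L).
{ clear HL; induction L as [|x L (c & d & H1 & H2 & H3 & H4)].
  - exists a, b; repeat split; try lra; intros t _ [].
  - destruct (Rle_lt_dec x ((c + d) / 2)).
    + exists ((c + 3 * d) / 4), d; repeat split; try lra.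
      intros t Ht [->|Hi]; [lra|apply (H4 t); [lra|exact Hi]].
    + exists c, ((c + d) / 2); repeat split; try lra.
      intros t Ht [->|Hi]; [lra|apply (H4 t); [lra|exact Hi]]. }
destruct K as (c & d & H1 & H2 & H3 & H4); exists c, d; repeat split; try assumption.
intros t Ht Qt; apply (H4 t Ht), HL, Qt.
Qed.

(** Nested closed intervals, each step avoiding one more [Q n]; the supremum of the left endpoints
    lies in all of them. *)
Lemma countable_union_finite (Q : nat -> R -> Prop) :
  (forall n, finite_pred (Q n)) -> exists t, forall n, ~ Q n t.
Proof.
intro HQ.
assert (S : forall n (I : {p : R * R | fst p < snd p}), {J : {p : R * R | fst p < snd p} |
  fst (proj1_sig I) <= fst (proj1_sig J) /\ snd (proj1_sig J) <= snd (proj1_sig I) /\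
  forall t, fst (proj1_sig J) <= t <= snd (proj1_sig J) -> ~ Q n t}).
{ intros n [[a b] Hab]; apply constructive_indefinite_description; cbn in *.
  destruct (finite_avoid_interval (Q n) a b (HQ n) Hab) as (c & d & H1 & H2 & H3 & H4).
  exists (exist _ (c, d) H2); cbn; auto. }
assert (I0 : fst (0, 1) < snd (0, 1)) by (cbn; lra).
set (I := fix I n := match n with
  | O => exist (fun p : R * R => fst p < snd p) (0, 1) I0
  | S m => proj1_sig (S m (I m)) end).
set (a := fun n => fst (proj1_sig (I n))); set (b := fun n => snd (proj1_sig (I n))).
assert (St : forall n, a n <= a (Datatypes.S n) /\ b (Datatypes.S n) <= b n /\
  forall t, a (Datatypes.S n) <= t <= b (Datatypes.S n) -> ~ Q n t).
{ intro n; exact (proj2_sig (S n (I n))). }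
assert (Lt : forall n, a n < b n) by (intro n; exact (proj2_sig (I n))).
clearbody a b; clear I I0 S.
assert (M : forall n k, a n <= a (n + k)%nat /\ b (n + k)%nat <= b n).
{ intros n k; induction k as [|k IH]; [rewrite Nat.add_0_r; lra|].
  rewrite Nat.add_succ_r; destruct (St (n + k)%nat) as (? & ? & _); lra. }
assert (C : forall n m, a n <= b m).
{ intros n m; destruct (Nat.le_ge_cases n m) as [H|H].
  - replace m with (n + (m - n))%nat by lia; destruct (M n (m - n)%nat).
    pose proof (Lt (n + (m - n))%nat); lra.
  - replace n with (m + (n - m))%nat by lia; destruct (M m (n - m)%nat).
    pose proof (Lt (m + (n - m))%nat); lra. }
destruct (completeness (fun x => exists n, x = a n)) as [t [Ub Lb]].
- exists (b O); intros x [n ->]; apply C.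
- exists (a O), O; reflexivity.
- exists t; intro n; apply St; split; [apply Ub; eauto|].
  apply Lb; intros x [m ->]; apply C.
Qed.

Lemma cubic_finite (c0 c1 c2 c3 : R) : ~ (c0 = 0 /\ c1 = 0 /\ c2 = 0 /\ c3 = 0) ->
  finite_pred (fun t => c0 + c1 * t + c2 * t ^ 2 + c3 * t ^ 3 = 0).
Proof.
intro N.
assert (Lin : forall a b, ~ (a = 0 /\ b = 0) -> finite_pred (fun t => a + b * t = 0)).
{ intros a b H; destruct (classic (exists r, a + b * r = 0)) as [[r Hr]|H0].
  - exists [r]; intros t Ht; left.
    assert (b <> 0) by (intros ->; apply H; lra).
    apply Rmult_eq_reg_l with b; lra.
  - exists []; intros t Ht; apply H0; eauto. }
assert (Quad : forall a b c, ~ (a = 0 /\ b = 0 /\ c = 0) ->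
  finite_pred (fun t => a + b * t + c * t ^ 2 = 0)).
{ intros a b c H; destruct (classic (exists r, a + b * r + c * r ^ 2 = 0)) as [[r Hr]|H0].
  - destruct (Lin (b + c * r) c) as [L HL].
    { intros [E1 E2]; apply H; subst c; repeat split; nra. }
    exists (r :: L); intros t Ht.
    destruct (Req_dec t r); [now left|right].
    apply HL, Rmult_eq_reg_l with (t - r); [nra|lra].
  - exists []; intros t Ht; apply H0; eauto. }
destruct (classic (exists r, c0 + c1 * r + c2 * r ^ 2 + c3 * r ^ 3 = 0)) as [[r Hr]|H0].
- destruct (Quad (c1 + c2 * r + c3 * r ^ 2) (c2 + c3 * r) c3) as [L HL].
  { intros (E1 & E2 & E3); apply N; subst c3.
    assert (c2 = 0) by lra; subst c2; assert (c1 = 0) by lra; subst c1.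
    repeat split; lra. }
  exists (r :: L); intros t Ht.
  destruct (Req_dec t r); [now left|right].
  apply HL, Rmult_eq_reg_l with (t - r); [nra|lra].
- exists []; intros t Ht; apply H0; eauto.
Qed.

(** A curve of determinant 1 whose four entries are linearly independent polynomials, so a
    hyperplane through 0 in the space of matrices meets it at most three times. *)
Definition curve (t : R) : M2 := mkM2 (1 + t ^ 3) (t ^ 2) t 1.

Lemma ads_curve (t : R) : ads_pt (curve t).
Proof. unfold ads_pt, mdet, curve; cbn [m11 m12 m21 m22]; ring. Qed.

Lemma curve_finite (x y z w : R) (U V : M2) : ads_pt U -> ads_pt V ->
  ~ (x = 0 /\ y = 0 /\ z = 0 /\ w = 0) ->
  finite_pred (fun t => let k := mmul (mmul U (curve t)) V in
    x * m11 k + y * m12 k + z * m21 k + w * m22 k = 0).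
Proof.
intros DU DV N.
set (f := fun A => let k := mmul (mmul U A) V in
  x * m11 k + y * m12 k + z * m21 k + w * m22 k).
set (e11 := f (mkM2 1 0 0 0)); set (e12 := f (mkM2 0 1 0 0)).
set (e21 := f (mkM2 0 0 1 0)); set (e22 := f (mkM2 0 0 0 1)).
assert (Ef : forall A, f A = m11 A * e11 + m12 A * e12 + m21 A * e21 + m22 A * e22).
{ intro A; unfold e11, e12, e21, e22, f; cbn; ring. }
destruct (cubic_finite (e11 + e22) e21 e12 e11) as [L HL].
- intros (H1 & H2 & H3 & H4).
  assert (Z : forall K, x * m11 K + y * m12 K + z * m21 K + w * m22 K = 0).
  { intro K; assert (EK : mmul (mmul U (mmul (mmul (adj U) K) (adj V))) V = K).
    { rewrite !mmul_assoc, mmul_adj_r, mmul_1_l by exact DU.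
      now rewrite <- mmul_assoc, mmul_adj_l, mmul_1_r by exact DV. }
    rewrite <- EK at 1 2 3 4; change (f (mmul (mmul (adj U) K) (adj V)) = 0).
    rewrite Ef, H2, H3, H4; replace e22 with 0 by lra; ring. }
  apply N; pose proof (Z (mkM2 1 0 0 0)) as Z1; pose proof (Z (mkM2 0 1 0 0)) as Z2.
  pose proof (Z (mkM2 0 0 1 0)) as Z3; pose proof (Z (mkM2 0 0 0 1)) as Z4.
  cbn [m11 m12 m21 m22] in *; repeat split; lra.
- exists L; intros t Ht; apply HL.
  change (f (curve t) = 0) in Ht; rewrite Ef in Ht; unfold curve in Ht.
  cbn [m11 m12 m21 m22] in Ht; rewrite <- Ht; ring.
Qed.

(** Coordinates taking a crooked plane to {sep = 0}: [b] is true for left planes and false for right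
    ones, where [adj] inverts. *)
Definition chart (b : bool) (X Y h : M2) : M2 :=
  let k := mmul (mmul (adj X) h) (adj Y) in if b then k else adj k.

Definition unchart (b : bool) (X Y k : M2) : M2 :=
  mmul (mmul X (if b then k else adj k)) Y.

Lemma chart_unchart (b : bool) (X Y k : M2) : ads_pt X -> ads_pt Y ->
  chart b X Y (unchart b X Y k) = k.
Proof.
unfold chart, unchart; intros DX DY.
rewrite !mmul_assoc, mmul_adj_l, mmul_1_l by exact DX.
rewrite <- mmul_assoc, mmul_adj_r, mmul_1_r by exact DY.
destruct b; [reflexivity|apply adj_adj].
Qed.

Lemma unchart_chart (b : bool) (X Y h : M2) : ads_pt X -> ads_pt Y ->
  unchart b X Y (chart b X Y h) = h.
Proof.
unfold chart, unchart; intros DX DY.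
replace (if b then if b then mmul (mmul (adj X) h) (adj Y) else adj (mmul (mmul (adj X) h) (adj Y))
  else adj (if b then mmul (mmul (adj X) h) (adj Y) else adj (mmul (mmul (adj X) h) (adj Y))))
  with (mmul (mmul (adj X) h) (adj Y)) by (destruct b; [reflexivity|now rewrite adj_adj]).
rewrite !mmul_assoc, mmul_adj_r, mmul_1_l by exact DX.
now rewrite <- mmul_assoc, mmul_adj_l, mmul_1_r by exact DY.
Qed.

Lemma ads_chart (b : bool) (X Y h : M2) : ads_pt X -> ads_pt Y -> ads_pt h ->
  ads_pt (chart b X Y h).
Proof.
unfold ads_pt, chart; intros DX DY Dh.
destruct b; rewrite ?mdet_adj, !mdet_mmul, !mdet_adj, DX, DY, Dh; ring.
Qed.

Lemma ads_unchart (b : bool) (X Y k : M2) : ads_pt X -> ads_pt Y -> ads_pt k ->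
  ads_pt (unchart b X Y k).
Proof.
unfold ads_pt, unchart; intros DX DY Dh.
destruct b; rewrite !mdet_mmul, ?mdet_adj, DX, DY, Dh; ring.
Qed.

Lemma contM_chart (b : bool) (X Y : M2) : contM (chart b X Y).
Proof.
assert (H : contM (fun h => mmul (mmul (adj X) h) (adj Y)))
  by (apply contM_mmul; [apply contM_mmul|]; first [apply contM_const | apply contM_id]).
unfold chart; destruct b; [exact H|now apply contM_adj].
Qed.

Lemma contM_unchart (b : bool) (X Y : M2) : contM (unchart b X Y).
Proof.
assert (H : contM (fun k => if b then k else adj k))
  by (destruct b; [apply contM_id | apply contM_adj, contM_id]).
apply contM_mmul; [apply contM_mmul; [apply contM_const|exact H]|apply contM_const].
Qed.

Lemma unchart_mopp (b : bool) (X Y h : M2) : unchart b X Y (mopp h) = mopp (unchart b X Y h).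
Proof. destruct b; apply M2_eq; cbn; ring. Qed.

Lemma crooked_plane_chart (S : M2 -> Prop) : crooked_plane S ->
  exists b X Y, ads_pt X /\ ads_pt Y /\
    forall h, ads_pt h -> (S h <-> sep (chart b X Y h) = 0).
Proof.
assert (Lft : forall S, left_crooked_plane S -> exists X Y, ads_pt X /\ ads_pt Y /\
  forall h, ads_pt h -> (S h <-> sep (mmul (mmul (adj X) h) (adj Y)) = 0)).
{ clear S; intros S (l & g1 & g2 & V & D1 & D2 & H).
  destruct (Cset_frame l V) as (f & Df & Hf).
  assert (K : forall h, mmul (mmul (adj (mmul g2 f)) h) (adj (mmul (adj f) (adj g1)))
                = mmul (mmul (adj f) (mmul (mmul (adj g2) h) g1)) f).
  { intro h; rewrite !adj_mmul, !adj_adj, !mmul_assoc; reflexivity. }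
  unfold ads_pt in *.
  exists (mmul g2 f), (mmul (adj f) (adj g1)); split; [|split].
  - rewrite mdet_mmul, D2, Df; ring.
  - rewrite mdet_mmul, !mdet_adj, D1, Df; ring.
  - intros h Dh; rewrite H, K, minv_adj by assumption.
    assert (Dg : mdet (mmul (mmul (adj g2) h) g1) = 1)
      by (rewrite !mdet_mmul, mdet_adj, D1, D2, Dh; ring).
    rewrite (Hf _ Dg), sep_zero; [reflexivity|].
    rewrite !mdet_mmul, !mdet_adj, D1, D2, Dh, Df; ring. }
intros [H|(T & H & E)].
- destruct (Lft S H) as (X & Y & DX & DY & K); exists true, X, Y; auto.
- destruct (Lft T H) as (X & Y & DX & DY & K).
  (* X^-1 h^-1 Y^-1 is the inverse of Y h X, so the two frames are inverted and exchanged. *)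
  exists false, (adj Y), (adj X); unfold ads_pt in *; rewrite !mdet_adj; repeat split; try assumption.
  + intro Sh; apply E in Sh; [|assumption]; rewrite minv_adj in Sh by assumption.
    apply K in Sh; [|now rewrite mdet_adj].
    unfold chart; rewrite !adj_mmul, !adj_adj, mmul_assoc; exact Sh.
  + intro Z; apply E; [assumption|]; rewrite minv_adj by assumption.
    apply K; [now rewrite mdet_adj|].
    unfold chart in Z; rewrite !adj_mmul, !adj_adj, mmul_assoc in Z; exact Z.
Qed.

(** In its chart a crooked plane is contained in the three hyperplanes m21 = 0, m12 = 0 and m11 =
    m22. *)
Lemma crooked_plane_curve (S : M2 -> Prop) (U : M2) : crooked_plane S -> ads_pt U ->
  finite_pred (fun t => S (mmul U (curve t))).
Proof.
intros HS DU; destruct (crooked_plane_chart S HS) as (b & X & Y & DX & DY & E).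
assert (DU' : ads_pt (mmul (adj X) U)).
{ unfold ads_pt in *; rewrite mdet_mmul, mdet_adj, DX, DU; ring. }
assert (DY' : ads_pt (adj Y)) by (unfold ads_pt; now rewrite mdet_adj).
pose proof (curve_finite 0 0 1 0 _ _ DU' DY' ltac:(lra)) as F1.
pose proof (curve_finite 0 1 0 0 _ _ DU' DY' ltac:(lra)) as F2.
pose proof (curve_finite 1 0 0 (-1) _ _ DU' DY' ltac:(lra)) as F3.
destruct (finite_pred_or _ _ F1 (finite_pred_or _ _ F2 F3)) as [L HL].
exists L; intros t Ht; apply HL; cbv zeta.
assert (Dt : ads_pt (mmul U (curve t))).
{ unfold ads_pt in *; rewrite mdet_mmul, DU, ads_curve; ring. }
apply E in Ht; [|exact Dt].
apply sep_zero in Ht; [|now apply ads_chart].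
unfold chart in Ht; rewrite (mmul_assoc (adj X)) in Ht.
set (k := mmul (mmul (mmul (adj X) U) (curve t)) (adj Y)) in *.
destruct b; unfold zero_form, adj in Ht; cbn [m11 m12 m21 m22] in Ht; lra.
Qed.

(** * Regions bounded by crooked planes *)

Lemma opn_comp (U : M2 -> Prop) (T : M2 -> M2) : opn U -> contM T ->
  (forall A, ads_pt A -> ads_pt (T A)) -> opn (fun A => U (T A)).
Proof.
intros HU HT DT A DA UA; destruct (HU _ (DT A DA) UA) as [e [He K]].
destruct (contM_dist T HT A e He) as [d [Hd L]].
exists d; split; [exact Hd|]; intros B DB HB; apply K; auto.
Qed.

Lemma opn_finite_closed (n : nat) (Q : nat -> M2 -> Prop) :
  (forall j, (j < n)%nat -> opn (fun A => ~ Q j A)) ->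
  opn (fun A => ~ exists j, (j < n)%nat /\ Q j A).
Proof.
induction n as [|n IH]; intros H A DA NA.
- exists 1; split; [lra|]; intros B _ _ (j & Hj & _); lia.
- destruct (IH (fun j Hj => H j (Nat.lt_lt_succ_r _ _ Hj)) A DA) as [e [He K]].
  { intros (j & Hj & QA); apply NA; exists j; split; [lia|exact QA]. }
  destruct (H n (Nat.lt_succ_diag_r n) A DA) as [d [Hd L]].
  { intro QA; apply NA; exists n; split; [lia|exact QA]. }
  exists (Rmin e d); split; [now apply Rmin_pos|]; intros B DB HB (j & Hj & QB).
  pose proof (Rmin_l e d); pose proof (Rmin_r e d).
  destruct (Nat.eq_dec j n) as [->|N].
  + apply (L B DB); [lra|exact QB].
  + apply (K B DB); [lra|exists j; split; [lia|exact QB]].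
Qed.

Lemma crooked_plane_closed (S : M2 -> Prop) : crooked_plane S -> opn (fun A => ~ S A).
Proof.
intros HS A DA NA; destruct (crooked_plane_chart S HS) as (b & X & Y & DX & DY & E).
assert (C : cont (fun h => Rabs (sep (chart b X Y h))))
  by (apply cont_abs, cont_compM; [apply cont_sep | apply contM_chart]).
destruct (cont_pos _ A C) as [d [Hd K]].
{ apply Rabs_pos_lt; intro Z; apply NA, E; assumption. }
exists d; split; [exact Hd|]; intros B DB HB SB.
specialize (K B HB); apply E in SB; [|exact DB].
cbv beta in K; rewrite SB, Rabs_R0 in K; lra.
Qed.

Lemma opn_interior (S : M2 -> Prop) : opn (interior S).
Proof.
intros A DA (_ & e & He & K); exists (e / 2); split; [lra|]; intros B DB HB.
split; [exact DB|]; exists (e / 2); split; [lra|]; intros C DC [H|H]; apply K; try assumption.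
- left; pose proof (mdist_tri A B C); lra.
- right; pose proof (mdist_tri A B (mopp C)); lra.
Qed.

Lemma interior_sub (S : M2 -> Prop) (A : M2) : interior S A -> S A.
Proof.
intros (DA & e & He & K); apply K; [exact DA|left]; now rewrite mdist_refl.
Qed.

Lemma interior_mopp (S : M2 -> Prop) (A : M2) : interior S A -> interior S (mopp A).
Proof.
intros (DA & e & He & K); split; [unfold ads_pt; now rewrite mdet_mopp|].
exists e; split; [exact He|]; intros B DB [H|H]; apply K; try assumption.
- right; now rewrite <- mdist_mopp, mopp_mopp.
- left; now rewrite mdist_mopp in H.
Qed.

Lemma opn_complement (S : M2 -> Prop) : closed S -> opn (fun A => ~ S A).
Proof.
intros Cl A DA NA; apply NNPP; intro H; apply NA, Cl; split; [exact DA|].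
intros e He; apply NNPP; intro H'; apply H; exists e; split; [exact He|].
intros B DB HB SB; apply H'; exists B; split; [exact DB|split; [exact SB|now left]].
Qed.

Lemma interior_translate (S : M2 -> Prop) (w : list letter) (A : M2) :
  interior S A -> interior (translate gens w S) (mmul (word_mat w) A).
Proof.
intros (DA & e & He & K).
assert (Dw := mdet_word_mat w).
assert (Dadj : forall B, ads_pt B -> ads_pt (mmul (adj (word_mat w)) B)).
{ unfold ads_pt; intros B DB; rewrite mdet_mmul, mdet_adj, Dw, DB; ring. }
split; [unfold ads_pt in *; rewrite mdet_mmul, Dw, DA; ring|].
destruct (contM_dist (fun B => mmul (adj (word_mat w)) B)
  (contM_mmul _ _ (contM_const _) contM_id) (mmul (word_mat w) A) e He) as [d [Hd L]].
assert (EA : mmul (adj (word_mat w)) (mmul (word_mat w) A) = A)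
  by (now rewrite mmul_assoc, mmul_adj_l, mmul_1_l by exact Dw).
assert (EB : forall B, mmul (word_mat w) (mmul (adj (word_mat w)) B) = B)
  by (intro B; now rewrite mmul_assoc, mmul_adj_r, mmul_1_l by exact Dw).
cbv beta in L; rewrite EA in L.
exists d; split; [exact Hd|]; intros B DB [H|H].
- exists (mmul (adj (word_mat w)) B); split; [now apply Dadj|split].
  + apply K; [now apply Dadj|left; now apply L].
  + left; now rewrite act_word_mat, EB.
- assert (DB' : ads_pt (mopp B)) by (unfold ads_pt; now rewrite mdet_mopp).
  exists (mmul (adj (word_mat w)) (mopp B)); split; [now apply Dadj|split].
  + apply K; [now apply Dadj|left; now apply L].
  + right; now rewrite act_word_mat, EB, mopp_mopp.
Qed.

Lemma interior_no_overlap (S : M2 -> Prop) (M A : M2) :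
  (forall w w', reduced 2 w -> reduced 2 w' -> w <> w' ->
     forall A, ~ (interior (translate gens w S) A /\ interior (translate gens w' S) A)) ->
  in_group M -> M <> mI -> interior S A -> interior S (mmul (adj M) A) -> False.
Proof.
intros Int (w & Hw & ->) N IA IB.
apply (Int [] w) with (A := A); [split; [constructor|exact Logic.I]|exact Hw| |split].
- intros <-; apply N; reflexivity.
- rewrite <- (mmul_1_l A); exact (interior_translate S [] A IA).
- apply (interior_translate S w) in IB.
  rewrite mmul_assoc, mmul_adj_r, mmul_1_l in IB by apply mdet_word_mat; exact IB.
Qed.

Lemma boundary_eq (S : M2 -> Prop) (A : M2) : closed S -> ads_pt A ->
  (boundary S A <-> S A /\ ~ interior S A).
Proof.
intros Cl DA; split; intros [H1 H2]; (split; [|exact H2]); [now apply Cl|].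
split; [exact DA|]; intros e He; exists A; split; [exact DA|split; [exact H1|left]].
now rewrite mdist_refl.
Qed.

(* Otherwise the region would be a finite union of crooked planes, and the translates of
   these, countable in number, each meet [curve] in a finite set. *)
Lemma interior_nonempty (S : M2 -> Prop) (P : list (M2 -> Prop)) :
  aset S -> (forall A, ads_pt A -> S A -> ~ interior S A -> exists Q, In Q P /\ Q A) ->
  (forall Q, In Q P -> crooked_plane Q) ->
  (forall A, ads_pt A -> exists w, reduced 2 w /\ translate gens w S A) ->
  exists A, interior S A.
Proof.
intros As Bd HP Cov; apply NNPP; intro Em.
assert (Dw : forall w, ads_pt (adj (word_mat w)))
  by (intro w; unfold ads_pt; rewrite mdet_adj; apply mdet_word_mat).
set (Bad := fun (n : nat) t => exists w, (reduced 2 w /\ (length w <= n)%nat) /\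
  exists Q, In Q P /\ Q (mmul (adj (word_mat w)) (curve t))).
destruct (countable_union_finite Bad) as [t Ht].
- intro n; destruct (words_finite n) as [L HL].
  destruct (finite_union L (fun w t => exists Q, In Q P /\ Q (mmul (adj (word_mat w)) (curve t))))
    as [L' HL'].
  + intros w _; apply finite_union; intros Q HQ; apply crooked_plane_curve; auto.
  + exists L'; intros t (w & [Hw1 Hw2] & H); apply HL'; exists w; auto.
- destruct (Cov (curve t) (ads_curve t)) as (w & Hw & A & DA & SA & E).
  rewrite act_word_mat in E.
  assert (SC : S (mmul (adj (word_mat w)) (curve t))).
  { destruct E as [-> | ->].
    - now rewrite mmul_assoc, mmul_adj_l, mmul_1_l by apply mdet_word_mat.
    - rewrite mmul_mopp_r, mmul_assoc, mmul_adj_l, mmul_1_l by apply mdet_word_mat.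
      exact (proj1 (As A DA) SA). }
  destruct (Bd (mmul (adj (word_mat w)) (curve t))) as (Q & HQ & HA).
  + unfold ads_pt in *; rewrite mdet_mmul, Dw, ads_curve; ring.
  + exact SC.
  + intro I; apply Em; eauto.
  + apply (Ht (length w)); exists w; repeat split; try apply Hw; eauto.
Qed.

(** Left multiplication commutes with the right factor Y, so M acts in either kind of chart through
    the same u = X^-1 M X. Thus one binary form, built from the columns of X, handles left and right
    planes alike. *)
Lemma pinched_group (b : bool) (X Y : M2) : ads_pt X -> ads_pt Y ->
  exists M T, in_group M /\ M <> mI /\ contM T /\ (forall A, ads_pt A -> ads_pt (T A)) /\
    pinched T /\ forall m, unchart b X Y (T m) = mmul (adj M) (unchart b X Y m).
Proof.
intros DX DY.
destruct (form_small (m11 X) (m21 X) (m12 X) (m22 X)) as (p & q & N & Hf).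
{ replace (m11 X * m22 X - m21 X * m12 X) with (mdet X) by (unfold mdet; ring).
  rewrite DX; ring. }
destruct (parabolic_in_group (Z.to_nat (Z.abs p + Z.abs q)) p q N ltac:(lia))
  as (e & k & He & Hk & G).
set (M := parabolic e k p q) in *.
set (u := mmul (mmul (adj X) M) X).
assert (DM : mdet M = 1) by (destruct G as (w & _ & ->); apply mdet_word_mat).
assert (Du : ads_pt u).
{ unfold ads_pt, u in *; rewrite !mdet_mmul, mdet_adj, DX, DM; ring. }
(* In the basis X the diagonal entries of M become e (1 + 2 k L1 L2), e (1 - 2 k L1 L2),
   where (L1, L2) = (p, q) X. *)
set (z := 2 * k * form (m11 X) (m21 X) (m12 X) (m22 X) p q).
set (L1 := m11 X * IZR p + m21 X * IZR q); set (L2 := m12 X * IZR p + m22 X * IZR q).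
destruct (pinched_parabolic u e z Du He) as [PL PR].
- transitivity (e * (mdet X + z)); [|now rewrite DX].
  unfold u, M, parabolic, z, form, mdet; cbn [mmul adj m11 m12 m21 m22]; ring.
- transitivity (e * (mdet X - z)); [|now rewrite DX].
  unfold u, M, parabolic, z, form, mdet; cbn [mmul adj m11 m12 m21 m22]; ring.
- unfold z; rewrite !Rabs_mult, (Rabs_right 2), (Rabs_right k) by lra.
  pose proof (Rabs_pos (form (m11 X) (m21 X) (m12 X) (m22 X) p q)); nra.
(* Where the form vanishes, M fixes an endpoint of the geodesic and u is triangular. *)
- intro Z; unfold z in Z.
  assert (F : L1 * L2 = 0).
  { change (form (m11 X) (m21 X) (m12 X) (m22 X) p q = 0).
    apply Rmult_eq_reg_l with (2 * k); lra. }
  destruct (Rmult_integral _ _ F) as [Z1|Z2]; [right|left].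
  + transitivity (- (e * (2 * k * L1 ^ 2))); [|rewrite Z1; ring].
    unfold u, M, parabolic, L1; cbn [mmul adj m11 m12 m21 m22]; ring.
  + transitivity (e * (2 * k * L2 ^ 2)); [|rewrite Z2; ring].
    unfold u, M, parabolic, L2; cbn [mmul adj m11 m12 m21 m22]; ring.
- assert (NM : M <> mI) by (apply parabolic_neq_1; tauto).
  assert (EX : forall A, mmul X (mmul (adj X) A) = A)
    by (intro A; now rewrite mmul_assoc, mmul_adj_r, mmul_1_l by exact DX).
  destruct b.
  + exists M, (lmul u); destruct (lmul_good u Du); repeat split; try assumption; try apply H.
    intro m; unfold unchart, lmul, u; rewrite !adj_mmul, adj_adj, <- !mmul_assoc, EX; reflexivity.
  + exists M, (rmul u); destruct (rmul_good u Du); repeat split; try assumption; try apply H.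
    intro m; unfold unchart, rmul, u; rewrite !adj_mmul, adj_adj, <- !mmul_assoc, EX; reflexivity.
Qed.

Lemma gens_no_crooked_domain (Rg : M2 -> Prop) : ~ crooked_fundamental_domain 2 gens Rg.
Proof.
intros (As & Cl & (P & HP & Disj & Bd) & Cov & Int).
assert (BdI : forall A, ads_pt A -> Rg A -> ~ interior Rg A -> exists Q, In Q P /\ Q A).
{ intros A DA RA NI; apply Bd; [exact DA|]; apply boundary_eq; auto. }
destruct (interior_nonempty Rg P As BdI HP Cov) as [A1 I1].
assert (D1 : ads_pt A1) by apply I1.
assert (OpI := opn_interior Rg); assert (OpE := opn_complement Rg Cl).
(* The interior has a frontier point. Otherwise it would be open and closed along the unipotent path
   from A1 to its image under the first generator, and the region would overlap its translate. *)
assert (St : exists A0, ads_pt A0 /\ ~ interior Rg A0 /\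
  forall e, 0 < e -> exists B, ads_pt B /\ interior Rg B /\ mdist A0 B < e).
{ apply NNPP; intro H.
  assert (OpN : opn (fun A => ~ interior Rg A)).
  { intros A DA NA; apply NNPP; intro H'; apply H; exists A; split; [exact DA|split; [exact NA|]].
    intros e He; apply NNPP; intro H''; apply H'; exists e; split; [exact He|].
    intros B DB HB IB; apply H''; exists B; auto. }
  apply (interior_no_overlap Rg (letter_mat (0%nat, false)) (mmul (mkM2 1 (2 * 1) 0 1) A1) Int).
  - apply in_group_gen; cbn; lia.
  - intro E; apply (f_equal m12) in E; cbn in E; lra.
  - apply (opn_path (interior Rg) (fun A => ~ interior Rg A)
      (fun t => mmul (mkM2 1 (2 * t) 0 1) A1) OpI OpN); [tauto| |].
    + intros t _; split; [|split; [|apply classic]].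
      * clear; destruct A1; path_continuity.
      * unfold ads_pt in *; rewrite mdet_mmul, D1; unfold mdet; cbn; ring.
    + replace (mmul (mkM2 1 (2 * 0) 0 1) A1) with A1 by (apply M2_eq; cbn; ring); exact I1.
  - replace (mmul (adj _) _) with A1 by (apply M2_eq; cbn; ring); exact I1. }
destruct St as (A0 & D0 & N0 & C0).
assert (R0 : Rg A0).
{ apply Cl; split; [exact D0|]; intros e He; destruct (C0 e He) as (B & DB & IB & HB).
  exists B; split; [exact DB|split; [now apply interior_sub|now left]]. }
destruct (BdI A0 D0 R0 N0) as (Q & HQ & QA0).
destruct (crooked_plane_chart Q (HP Q HQ)) as (b & X & Y & DX & DY & EQ).
destruct (In_nth P Q (fun _ => False) HQ) as (i & Hi & Ei).
(* The remaining boundary planes, separated from Q by their index in the list. *)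
set (O := fun A => exists j, (j < length P)%nat /\ (j <> i /\ nth j P (fun _ => False) A)).
set (f := unchart b X Y).
assert (Df : forall A, ads_pt A -> ads_pt (f A)) by (intros; now apply ads_unchart).
assert (Cf : contM f) by apply contM_unchart.
assert (Qf : forall k, ads_pt k -> (Q (f k) <-> sep k = 0)).
{ intros k Dk; rewrite EQ by auto; unfold f; now rewrite chart_unchart. }
(* Off all boundary planes a point is interior to the region or outside it, so U and V cover the
   complement of the planes. *)
set (U := fun k => interior Rg (f k)); set (V := fun k => ~ Rg (f k)).
assert (OpU : opn U) by (exact (opn_comp _ f OpI Cf Df)).
assert (OpV : opn V) by (exact (opn_comp _ f OpE Cf Df)).
assert (OpO : opn (fun k => ~ O (f k))).
{ apply (opn_comp (fun A => ~ O A) f); auto; apply opn_finite_closed; intros j Hj.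
  destruct (Nat.eq_dec j i) as [->|Nj].
  - intros A _ _; exists 1; split; [lra|]; intros B _ _ []; contradiction.
  - intros A DA NA; destruct (crooked_plane_closed _ (HP _ (nth_In P (fun _ => False) Hj)) A DA)
      as [e [He K]]; [tauto|].
    exists e; split; [exact He|]; intros B DB HB []; now apply (K B). }
assert (UV : forall k, ads_pt k -> U k -> V k -> False)
  by (intros k _ Uk Vk; apply Vk, interior_sub, Uk).
assert (Um : forall k, ads_pt k -> U k -> U (mopp k)).
{ intros k _ Uk; unfold U, f; rewrite unchart_mopp; now apply interior_mopp. }
assert (ZO : forall k, ads_pt k -> sep k = 0 -> ~ O (f k)).
{ intros k Dk Zk (j & Hj & Nj & Hn).
  apply (Disj j i Hj Hi Nj (f k) (Df k Dk)); split; [exact Hn|].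
  rewrite Ei; now apply Qf. }
assert (UVc : forall k, ads_pt k -> sep k <> 0 -> ~ O (f k) -> U k \/ V k).
{ intros k Dk Zk NO; unfold U, V.
  destruct (classic (Rg (f k))) as [Rk|]; [|now right].
  destruct (classic (interior Rg (f k))) as [|Nk]; [now left|exfalso].
  destruct (BdI (f k) (Df k Dk) Rk Nk) as (Q' & HQ' & Qk).
  destruct (In_nth P Q' (fun _ => False) HQ') as (j & Hj & Ej).
  destruct (Nat.eq_dec j i) as [->|Nj].
  - apply Zk, Qf; [exact Dk|]; rewrite <- Ei, Ej; exact Qk.
  - apply NO; exists j; rewrite Ej; auto. }
set (k0 := chart b X Y A0).
assert (Dk0 : ads_pt k0) by now apply ads_chart.
assert (Zk0 : sep k0 = 0) by now apply EQ.
assert (Dich : forall eta, eta ^ 2 = 1 -> half_in U eta k0 \/ half_in V eta k0)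
  by (intros eta He; apply (half_in_dichotomy U V (fun k => O (f k))); auto).
(* If both sides were outside the region near [k0], interior points close to A0 would have to lie on
   Q, hence on the boundary. *)
assert (Side : exists eta, eta ^ 2 = 1 /\ half_in U eta k0).
{ destruct (Dich 1 ltac:(ring)) as [|(e1 & He1 & V1)]; [exists 1; split; [ring|assumption]|].
  destruct (Dich (-1) ltac:(ring)) as [|(e2 & He2 & V2)]; [exists (-1); split; [ring|assumption]|].
  exfalso.
  destruct (contM_dist _ (contM_chart b X Y) A0 (Rmin e1 e2)) as [d [Hd K]];
    [now apply Rmin_pos|].
  destruct (C0 d Hd) as (B & DB & IB & HB).
  specialize (K B HB); fold k0 in K.
  pose proof (Rmin_l e1 e2); pose proof (Rmin_r e1 e2).
  assert (EB : f (chart b X Y B) = B) by (unfold f; now apply unchart_chart).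
  assert (DB' : ads_pt (chart b X Y B)) by now apply ads_chart.
  assert (NV : ~ V (chart b X Y B))
    by (intro VB; apply (UV _ DB'); [unfold U; now rewrite EB|exact VB]).
  destruct (Rtotal_order (sep (chart b X Y B)) 0) as [L|[L|L]].
  - apply NV, V2; [exact DB'|lra|lra].
  - apply (EQ B DB) in L.
    assert (Bb : boundary Rg B) by (apply Bd; eauto).
    now apply Bb.
  - apply NV, V1; [exact DB'|lra|lra]. }
destruct Side as (eta & He & H0).
assert (All : forall k, ads_pt k -> sep k = 0 -> half_in U eta k)
  by (intros k Dk Zk; apply (half_in_spread U V (fun k => O (f k)) eta k0 k); auto).
destruct (pinched_group b X Y DX DY) as (M & T & GM & NM & CT & DT & (k & Dk & Z1 & Z2 & Hp) & ET).
destruct (All k Dk Z1) as (e1 & He1 & K1).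
destruct (All (T k) (DT k Dk) Z2) as (e2 & He2 & K2).
destruct (contM_dist T CT k e2 He2) as [d [Hd L]].
destruct (Hp eta (Rmin e1 d) He) as (m & Dm & Hm & S1 & S2); [now apply Rmin_pos|].
pose proof (Rmin_l e1 d); pose proof (Rmin_r e1 d).
apply (interior_no_overlap Rg M (f m) Int GM NM).
- apply K1; [exact Dm|lra|exact S1].
- unfold f; rewrite <- ET; apply K2; [now apply DT|apply L; lra|exact S2].
Qed.

Theorem theorem1p1 :
  exists (n : nat) (gen : nat -> M2 * M2),
    (forall i, (i < n)%nat -> isom_plus (gen i)) /\
    properly_discontinuous n gen /\
    ~ (exists Rg : M2 -> Prop, crooked_fundamental_domain n gen Rg).
Proof.
exists 2%nat, gens; split; [|split].
- intros i _; unfold isom_plus, gens; cbn [fst snd]; rewrite mdet_gen_mat.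
  assert (mdet mI = 1) by (unfold mdet; cbn; ring); auto.
- exact gens_properly_discontinuous.
- intros [Rg H]; exact (gens_no_crooked_domain Rg H).
Qed.
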